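(* There is an absolute constant $C>0$ such that for every finite set $\Sigma$, every $n\ge1$, every $\mathbb{X}\subseteq\Sigma^n$, all $|\mathbb{X}|\times|\mathbb{X}|$ Gram matrices $\rho,\sigma$ of unit vectors, and every $\varepsilon\in(0,1)$, $$Q^{\mathrm{ct}}_\varepsilon(\rho,\sigma)\;\le\;C\,\frac{\mathrm{Adv}^\star(\rho,\sigma)}{\varepsilon},$$ i.e. $Q^{\mathrm{ct}}_\varepsilon(\rho,\sigma)=O(\mathrm{Adv}^\star(\rho,\sigma)/\varepsilon)$, where the continuous-time query model uses the oracle $h(y)=|y^-\rangle\langle y^-|$.
   Context: Notation: $(A\circ B)_{ij}=A_{ij}B_{ij}$, $\|A\|$ is the operator norm. Adversary bound: for $j\in[n]$ let $\Delta_j$ be the $|\mathbb{X}|\times|\mathbb{X}|$ matrix with $(\Delta_j)_{x,y}=1-\delta_{x_j,y_j}$. $\mathrm{Adv}^\star(\rho,\sigma)=\max_{\Gamma}\|\Gamma\circ(\rho-\sigma)\|$ over Hermitian $|\mathbb{X}|\times|\mathbb{X}|$ matrices $\Gamma$ with $\|\Gamma\circ\Delta_j\|\le 1$ for all $j\in[n]$. Oracle: let $\bar0$ be a symbol not in $\Sigma$, $\mathbb{C}^{\Sigma\cup\{\bar0\}}$ with orthonormal basis $\{|y\rangle\}$, and $|y^\pm\rangle=\frac1{\sqrt2}(|\bar0\rangle\pm|y\rangle)$ for $y\in\Sigma$. Take $h(y)=|y^-\rangle\langle y^-|$, and $H_{\mathcal Q}(x)=\sum_{j=1}^n|j\rangle\langle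 j|\otimes h(x_j)$ on $\mathbb{C}^n\otimes\mathbb{C}^{\Sigma\cup\{\bar 0\}}$. Continuous-time query model: an algorithm of duration $T$ acts on a finite-dimensional Hilbert space $\mathcal{H}=(\mathbb{C}^n\otimes\mathbb{C}^{\Sigma\cup\{\bar0\}}\otimes\mathbb{C}^w)\oplus\mathcal{H}'$ via $H_x(t)=H_{\mathcal D}(t)+\alpha(t)\,\widetilde H_{\mathcal Q}(x)$, $t\in[0,T]$, where $\widetilde H_{\mathcal Q}(x)$ acts as $H_{\mathcal Q}(x)\otimes I$ on the first summand and $0$ on $\mathcal H'$, $H_{\mathcal D}(t)$ is an input-independent Hermitian operator (piecewise continuous in $t$), and $\alpha:[0,T]\to\mathbb{R}$ with $|\alpha(t)|\le1$. $\mathcal U_x$ denotes the unitary generated at time $T$. With unit vectors $|\rho_x\rangle,|\sigma_x\rangle$ of Gram matrices $\rho,\sigma$ and a fixed workspace state $|0\rangle$, the algorithm converts $\rho$ to $\sigma$ with error at most $\varepsilon$ if $\mathrm{Re}\langle\sigma_x,0|\mathcal U_x|\rho_x,0\rangle\ge\sqrt{1-\varepsilon}$ for all $x\in\mathbb{X}$; $Q^{\mathrm{ct}}_\varepsilon(\rho,\sigma)$ is the infimum of $T$ over such algorithms (with $T=0$ allowed). *)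

(* Defs.v *)
From Stdlib Require Import Reals.
From HB Require Import structures.
From mathcomp Require Import all_boot.
Set Implicit Arguments.
Unset Strict Implicit.
Unset Printing Implicit Defensive.
Open Scope R_scope.

Definition Cx := (R * R)%type.
Definition C0 : Cx := (0, 0).
Definition C1 : Cx := (1, 0).
Definition Cadd (a b : Cx) : Cx := (fst a + fst b, snd a + snd b).
Definition Copp (a : Cx) : Cx := (- fst a, - snd a).
Definition Csub (a b : Cx) : Cx := Cadd a (Copp b).
Definition Cmul (a b : Cx) : Cx :=
  (fst a * fst b - snd a * snd b, fst a * snd b + snd a * fst b).
Definition Cconj (a : Cx) : Cx := (fst a, - snd a).
Definition Cscal (r : R) (a : Cx) : Cx := (r * fst a, r * snd a).
Definition Cnorm2 (a : Cx) : R := fst a * fst a + snd a * snd a.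
Definition Ci : Cx := (0, 1).

Definition vec (I : finType) := I -> Cx.
Definition mat (I : finType) := I -> I -> Cx.

Definition csum (I : finType) (F : I -> Cx) : Cx := \big[Cadd/C0]_(i : I) F i.
Definition rsum (I : finType) (F : I -> R) : R := \big[Rplus/0]_(i : I) F i.

Definition vnorm (I : finType) (v : vec I) : R := sqrt (rsum (fun i => Cnorm2 (v i))).
Definition inner (I : finType) (u v : vec I) : Cx :=
  csum (fun i => Cmul (Cconj (u i)) (v i)).
Definition mulmv (I : finType) (A : mat I) (v : vec I) : vec I :=
  fun i => csum (fun j => Cmul (A i j) (v j)).
Definition mulmm (I : finType) (A B : mat I) : mat I :=
  fun i k => csum (fun j => Cmul (A i j) (B j k)).
Definition idmat (I : finType) : mat I := fun i j => if i == j then C1 else C0.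
Definition hadamard (I : finType) (A B : mat I) : mat I := fun i j => Cmul (A i j) (B i j).
Definition msub (I : finType) (A B : mat I) : mat I := fun i j => Csub (A i j) (B i j).
Definition hermitian (I : finType) (A : mat I) : Prop := forall i j, A j i = Cconj (A i j).

Definition is_opnorm (I : finType) (A : mat I) (r : R) : Prop :=
  is_lub (fun s => exists v : vec I, vnorm v = 1 /\ s = vnorm (mulmv A v)) r.
Definition opnorm_le (I : finType) (A : mat I) (c : R) : Prop :=
  forall v : vec I, vnorm (mulmv A v) <= c * vnorm v.

Definition unit_gram (I : finType) (rho : mat I) : Prop :=
  exists (m : nat) (v : I -> vec 'I_m),
    (forall x, vnorm (v x) = 1) /\ (forall x y, rho x y = inner (v x) (v y)).

Definition Xidx (S : finType) (n : nat) (X : {set n.-tuple S}) : finType :=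
  {x : n.-tuple S | x \in X}.

Definition Delta (S : finType) (n : nat) (X : {set n.-tuple S}) (j : 'I_n)
  : mat (Xidx X) :=
  fun x y => if tnth (val x) j == tnth (val y) j then C0 else C1.

Definition adv_feasible (S : finType) (n : nat) (X : {set n.-tuple S})
  (G : mat (Xidx X)) : Prop :=
  hermitian G /\ forall j : 'I_n, opnorm_le (hadamard G (@Delta _ _ X j)) 1.
Definition adv_values (S : finType) (n : nat) (X : {set n.-tuple S})
  (rho sigma : mat (Xidx X)) (r : R) : Prop :=
  exists G, adv_feasible G /\ is_opnorm (hadamard G (msub rho sigma)) r.
Definition is_Adv (S : finType) (n : nat) (X : {set n.-tuple S})
  (rho sigma : mat (Xidx X)) (a : R) : Prop :=
  is_lub (adv_values rho sigma) a.

(* ---------- the algorithm's Hilbert space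
   H = (C^n ⊗ C^{Σ ∪ {0bar}} ⊗ C^w) ⊕ H',  dim H' = d;
   0bar is represented by None : option Σ ---------- *)
Definition Idx (S : finType) (n w d : nat) : finType :=
  ((('I_n * option S) * 'I_w) + 'I_d)%type.

(* coordinates of |y^-> = (|0bar> - |y>)/sqrt 2 *)
Definition ycoef (S : finType) (y : S) (a : option S) : R :=
  match a with
  | None => / sqrt 2
  | Some z => if z == y then - / sqrt 2 else 0
  end.
Definition hmat (S : finType) (y : S) (a b : option S) : Cx :=
  (ycoef y a * ycoef y b, 0).
(* tilde H_Q(x) = (sum_j |j><j| ⊗ h(x_j)) ⊗ I_w  ⊕ 0_{H'} *)
Definition HQ (S : finType) (n w d : nat) (x : n.-tuple S) : mat (Idx S n w d) :=
  fun p q =>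
    match p, q with
    | inl ((j, a), k), inl ((j', b), k') =>
        if (j == j') && (k == k') then hmat (tnth x j) a b else C0
    | _, _ => C0
    end.

Definition Hx (S : finType) (n w d : nat) (HD : R -> mat (Idx S n w d))
  (alpha : R -> R) (x : n.-tuple S) (t : R) : mat (Idx S n w d) :=
  fun p q => Cadd (HD t p q) (Cscal (alpha t) (@HQ S n w d x p q)).

(* f is piecewise continuous on [a,b]: finitely many breakpoints, and on each
   open piece f agrees with a continuous function (so one-sided limits exist) *)
Definition pw_cont (f : R -> R) (a b : R) : Prop :=
  exists (k : nat) (pts : nat -> R),
    pts 0%nat = a /\ pts k = b /\
    (forall i, (i < k)%nat -> pts i < pts i.+1) /\
    (forall i, (i < k)%nat -> exists g : R -> R, continuity g /\
        forall t, pts i < t < pts i.+1 -> f t = g t).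

Definition generated (I : finType) (H : R -> mat I) (T : R) (U : R -> mat I) : Prop :=
  U 0 = @idmat I /\
  (forall t, 0 <= t <= T -> forall p q,
      limit1_in (fun s => fst (U s p q)) (fun s => 0 <= s <= T) (fst (U t p q)) t /\
      limit1_in (fun s => snd (U s p q)) (fun s => 0 <= s <= T) (snd (U t p q)) t) /\
  (exists bad : list R, forall t, 0 < t < T -> ~ List.In t bad -> forall p q,
      derivable_pt_lim (fun s => fst (U s p q)) t
        (fst (Cmul (Copp Ci) (mulmm (H t) (U t) p q))) /\
      derivable_pt_lim (fun s => snd (U s p q)) t
        (snd (Cmul (Copp Ci) (mulmm (H t) (U t) p q)))).

Definition ct_converts (S : finType) (n : nat) (X : {set n.-tuple S})
  (rho sigma : mat (Xidx X)) (eps T : R) : Prop :=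
  exists (w d : nat) (HD : R -> mat (Idx S n w d)) (alpha : R -> R)
         (U : Xidx X -> R -> mat (Idx S n w d))
         (psi phi : Xidx X -> vec (Idx S n w d)),
    0 <= T /\
    (forall t, 0 <= t <= T -> hermitian (HD t)) /\
    (forall p q, pw_cont (fun t => fst (HD t p q)) 0 T /\
                 pw_cont (fun t => snd (HD t p q)) 0 T) /\
    (forall t, 0 <= t <= T -> Rabs (alpha t) <= 1) /\
    (forall x : Xidx X, generated (Hx HD alpha (val x)) T (U x)) /\
    (forall x y, inner (psi x) (psi y) = rho x y /\ inner (phi x) (phi y) = sigma x y) /\
    (forall x, sqrt (1 - eps) <= fst (inner (phi x) (mulmv (U x T) (psi x)))).

(* Main.v *)
(** By semidefinite duality the adversary bound yields vectors [u_a], [v_a] whose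
    symmetrised products, restricted to the pairs differing in coordinate [j_a],
    sum to [rho - sigma] and whose total squared lengths are at most [adv + d].
    Duality is obtained by separating [rho - sigma], with the weight [adv] on its
    diagonal, from the cone of all decompositions; approximate separation is enough,
    since its error can be absorbed into the weights.

    From [|x_j^+> v + mu |x_j^-> u] one builds a catalyst whose Gram matrix a query of
    duration [tau] changes by exactly [(sigma - rho) / N].  Hence after each query the
    state [sqrt (1 - k/N) rho_x + sqrt (k/N) sigma_x + catalyst] has the Gram matrix of
    the next one, and an input-independent reflection, implemented with [alpha = 0] in
    an arbitrarily short time, maps one to the other.  After [N] rounds [rho_x] plus
    catalyst has become [sigma_x] plus catalyst exactly, so that omitting the catalyst,
    whose squared norm is [O(adv / (N tau))], costs an error of that order. *)

From Stdlib Require Import Reals Lra.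
From Stdlib Require Import FunctionalExtensionality Classical.
From Coquelicot Require Import Hierarchy Derive AutoDerive.
From HB Require Import structures.
From mathcomp Require Import all_boot.
Require Import Defs.
Set Implicit Arguments.
Unset Strict Implicit.
Unset Printing Implicit Defensive.
Open Scope R_scope.

(** * Complex arithmetic and finite sums *)

Fact RplusA : associative Rplus.
Proof. by move=> a b c; ring. Qed.

HB.instance Definition _ :=
  Monoid.isComLaw.Build R 0 Rplus RplusA Rplus_comm Rplus_0_l.
HB.instance Definition _ := Monoid.isMulLaw.Build R 0 Rmult Rmult_0_l Rmult_0_r.
HB.instance Definition _ :=
  Monoid.isAddLaw.Build R Rmult Rplus Rmult_plus_distr_r Rmult_plus_distr_l.

Definition RtoC (r : R) : Cx := (r, 0).

Declare Scope Cx_scope.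
Delimit Scope Cx_scope with Cx.
Bind Scope Cx_scope with Cx.
Infix "+" := Cadd : Cx_scope.
Infix "-" := Csub : Cx_scope.
Infix "*" := Cmul : Cx_scope.
Notation "- a" := (Copp a) : Cx_scope.
Notation "a ^*" := (Cconj a) : Cx_scope.
Notation "r %:C" := (RtoC r) (at level 2, left associativity, format "r %:C").

Lemma Cx_eq (a b : Cx) : fst a = fst b -> snd a = snd b -> a = b.
Proof. by case: a => ? ?; case: b => ? ? /= -> ->. Qed.

Ltac by_coords := apply: Cx_eq;
  rewrite /Csub /Cadd /Copp /Cmul /Cconj /Cscal /Cnorm2 /RtoC /C0 /C1 /Ci /=;
  first [ring | by field; lra | lra].

Lemma Cx_ring : ring_theory C0 C1 Cadd Cmul Csub Copp (@eq Cx).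
Proof. by split; intros; by_coords. Qed.

Add Ring CxRing : Cx_ring.

Fact CaddA : associative Cadd. Proof. by move=> a b c; ring. Qed.
Fact CaddC : commutative Cadd. Proof. by move=> a b; ring. Qed.
Fact Cadd0 : left_id C0 Cadd. Proof. by move=> a; ring. Qed.
Fact Cmul0l : left_zero C0 Cmul. Proof. by move=> a; ring. Qed.
Fact Cmul0r : right_zero C0 Cmul. Proof. by move=> a; ring. Qed.
Fact CmulDl : left_distributive Cmul Cadd. Proof. by move=> a b c; ring. Qed.
Fact CmulDr : right_distributive Cmul Cadd. Proof. by move=> a b c; ring. Qed.

HB.instance Definition _ := Monoid.isComLaw.Build Cx C0 Cadd CaddA CaddC Cadd0.
HB.instance Definition _ := Monoid.isMulLaw.Build Cx C0 Cmul Cmul0l Cmul0r.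
HB.instance Definition _ := Monoid.isAddLaw.Build Cx Cmul Cadd CmulDl CmulDr.

Lemma CconjD a b : ((a + b)^* = a^* + b^*)%Cx. Proof. by by_coords. Qed.
Lemma CconjB a b : ((a - b)^* = a^* - b^*)%Cx. Proof. by by_coords. Qed.
Lemma CconjM a b : ((a * b)^* = a^* * b^*)%Cx. Proof. by by_coords. Qed.
Lemma CconjK a : (a^*^* = a)%Cx. Proof. by by_coords. Qed.
Lemma Cconj_real r : (r%:C^* = r%:C)%Cx. Proof. by by_coords. Qed.
Lemma Cconj0 : (C0^* = C0)%Cx. Proof. by by_coords. Qed.
Lemma Cconj1 : (C1^* = C1)%Cx. Proof. by by_coords. Qed.

Definition CconjE := (CconjD, CconjB, CconjM, CconjK, Cconj_real, Cconj0, Cconj1).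

Lemma CscalE r a : Cscal r a = (r%:C * a)%Cx. Proof. by by_coords. Qed.
Lemma RtoCM r s : ((r * s)%:C = r%:C * s%:C)%Cx. Proof. by by_coords. Qed.
Lemma Cconj_mul_self a : (a^* * a = (Cnorm2 a)%:C)%Cx. Proof. by by_coords. Qed.

Lemma Cnorm2_ge0 a : 0 <= Cnorm2 a. Proof. by rewrite /Cnorm2; nra. Qed.

Lemma Cnorm2M a b : Cnorm2 (a * b)%Cx = Cnorm2 a * Cnorm2 b.
Proof. by rewrite /Cnorm2 /=; ring. Qed.

Lemma Cnorm2_conj a : Cnorm2 (a^*)%Cx = Cnorm2 a.
Proof. by rewrite /Cnorm2 /=; ring. Qed.

Lemma Cnorm2_real r : Cnorm2 (r%:C)%Cx = r * r.
Proof. by rewrite /Cnorm2 /=; ring. Qed.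

Lemma Cnorm2_eq0 a : Cnorm2 a = 0 -> a = C0.
Proof. by rewrite /Cnorm2 => h; apply: Cx_eq => /=; nra. Qed.

Section Sums.
Variable I : finType.
Implicit Types (F G : I -> R) (P Q : I -> Cx).

Lemma eq_rsum F G : (forall i, F i = G i) -> rsum F = rsum G.
Proof. by move=> FG; apply: eq_bigr => i _; exact: FG. Qed.

Lemma rsumD F G : rsum (fun i => F i + G i) = rsum F + rsum G.
Proof. by rewrite /rsum big_split. Qed.

Lemma rsumZ c F : rsum (fun i => c * F i) = c * rsum F.
Proof. by rewrite /rsum big_distrr. Qed.

Lemma rsum_le F G : (forall i, F i <= G i) -> rsum F <= rsum G.
Proof. by move=> FG; apply: (big_ind2 Rle) => // *; lra. Qed.

Lemma rsum_eq0 F : (forall i, F i = 0) -> rsum F = 0.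
Proof. by move=> F0; rewrite /rsum big1. Qed.

Lemma rsum_ge0 F : (forall i, 0 <= F i) -> 0 <= rsum F.
Proof. by move=> F0; apply: big_ind => //; [lra | move=> *; lra]. Qed.

Lemma rsum_const (c : R) : rsum (fun _ : I => c) = INR #|I| * c.
Proof.
rewrite /rsum big_const; elim: #|I| => [|k IH]; first by rewrite /=; ring.
by rewrite iterS IH S_INR; ring.
Qed.

Lemma rsum_delta k F : rsum (fun i => if i == k then F i else 0) = F k.
Proof. by rewrite /rsum -big_mkcond big_pred1_eq. Qed.

Lemma term_le_rsum F k : (forall i, 0 <= F i) -> F k <= rsum F.
Proof.
move=> F0; rewrite -[F k](@rsum_delta k F); apply: rsum_le => i.
by case: eqP => _; [lra | exact: F0].
Qed.

Lemma eq_csum P Q : (forall i, P i = Q i) -> csum P = csum Q.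
Proof. by move=> PQ; apply: eq_bigr => i _; exact: PQ. Qed.

Lemma csumD P Q : csum (fun i => P i + Q i)%Cx = (csum P + csum Q)%Cx.
Proof. by rewrite /csum big_split. Qed.

Lemma csumZ c P : csum (fun i => c * P i)%Cx = (c * csum P)%Cx.
Proof. by rewrite /csum big_distrr. Qed.

Lemma csumZr c P : csum (fun i => P i * c)%Cx = (csum P * c)%Cx.
Proof. by rewrite /csum big_distrl. Qed.

Lemma csum_conj P : ((csum P)^* = csum (fun i => (P i)^*))%Cx.
Proof. exact: (big_morph Cconj CconjD Cconj0). Qed.

Lemma csum_eq0 P : (forall i, P i = C0) -> csum P = C0.
Proof. by move=> P0; rewrite /csum big1. Qed.

Lemma csum_delta k P : csum (fun i => if i == k then P i else C0) = P k.
Proof. by rewrite /csum -big_mkcond big_pred1_eq. Qed.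

Lemma csum_if (b : bool) P :
  csum (fun i => if b then P i else C0) = if b then csum P else C0.
Proof. by case: b => //; exact: csum_eq0. Qed.

Lemma fst_csum P : fst (csum P) = rsum (fun i => fst (P i)).
Proof. by rewrite /csum /rsum; apply: (big_morph (fun a : Cx => fst a)). Qed.

Lemma snd_csum P : snd (csum P) = rsum (fun i => snd (P i)).
Proof. by rewrite /csum /rsum; apply: (big_morph (fun a : Cx => snd a)). Qed.

End Sums.

Lemma csum_exchange (I J : finType) (P : I -> J -> Cx) :
  csum (fun i => csum (fun j => P i j)) = csum (fun j => csum (fun i => P i j)).
Proof. by rewrite /csum exchange_big. Qed.

Lemma rsum_pair (I J : finType) (F : I * J -> R) :
  rsum F = rsum (fun i => rsum (fun j => F (i, j))).
Proof. by rewrite /rsum pair_bigA; apply: eq_bigr; case. Qed.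

Lemma csum_pair (I J : finType) (P : I * J -> Cx) :
  csum P = csum (fun i => csum (fun j => P (i, j))).
Proof. by rewrite /csum pair_bigA; apply: eq_bigr; case. Qed.

Lemma rsum_sum (I J : finType) (F : I + J -> R) :
  rsum F = rsum (fun i => F (inl i)) + rsum (fun j => F (inr j)).
Proof. by rewrite /rsum big_sumType. Qed.

Lemma csum_sum (I J : finType) (P : I + J -> Cx) :
  csum P = (csum (fun i => P (inl i)) + csum (fun j => P (inr j)))%Cx.
Proof. by rewrite /csum big_sumType. Qed.

Lemma rsum_unit (F : unit -> R) : rsum F = F tt.
Proof. by rewrite /rsum (big_pred1 tt) //; case. Qed.

Lemma csum_unit (P : unit -> Cx) : csum P = P tt.
Proof. by rewrite /csum (big_pred1 tt) //; case. Qed.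

Lemma csum_bool (P : bool -> Cx) : csum P = (P true + P false)%Cx.
Proof. by rewrite /csum big_bool. Qed.

Lemma csum_option (I : finType) (P : option I -> Cx) :
  csum P = (P None + csum (fun i => P (Some i)))%Cx.
Proof.
rewrite /csum (bigD1 None) //=; congr Cadd.
rewrite (reindex_omap (@Some I) id) /=; last by case.
by apply: eq_bigl => i; rewrite eqxx.
Qed.

Lemma csum_enum_val (A : finType) (P : A -> Cx) :
  csum (fun k : 'I_#|A| => P (enum_val k)) = csum P.
Proof.
by rewrite /csum [RHS](reindex (@enum_val A A)) //=; exact/onW_bij/enum_val_bij.
Qed.

Lemma le_of_quadratic (x a b : R) : 0 <= a -> 0 <= b ->
  (forall s, 0 < s -> 2 * s * x <= a * a + s * s * (b * b)) -> x <= a * b.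
Proof.
move=> a0 b0 quad; apply: Rle_plus_epsilon => d d0.
pose e := Rmin 1 (d / (a + b + 1)).
have eL : e * (a + b + 1) <= d.
  have -> : d = d / (a + b + 1) * (a + b + 1) by field; lra.
  by apply: Rmult_le_compat_r (Rmin_r _ _); lra.
have e0 : 0 < e by apply: Rmin_pos; [lra | apply: Rdiv_lt_0_compat; lra].
have e1 : e <= 1 by exact: Rmin_l.
pose s := (a + e) / (b + e).
have s0 : 0 < s by apply: Rdiv_lt_0_compat; lra.
have sE : s * (b + e) = a + e by rewrite /s; field; lra.
have upper : s * x <= s * ((a + e) * (b + e)).
  have -> : s * ((a + e) * (b + e)) = (a + e) * (a + e) by rewrite -sE; ring.
  have := quad s s0.
  have : s * s * (b * b) <= (a + e) * (a + e) by rewrite -sE; nra.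
  nra.
have := Rmult_le_reg_l _ _ _ s0 upper; nra.
Qed.

(** * Vectors and matrices *)

Section Vectors.
Variable I : finType.
Implicit Types u v : vec I.

Definition vzero : vec I := fun=> C0.
Definition vadd u v : vec I := fun i => (u i + v i)%Cx.
Definition vsub u v : vec I := fun i => (u i - v i)%Cx.
Definition vscal c v : vec I := fun i => (c * v i)%Cx.
Definition delta (k : I) : vec I := fun i => if i == k then C1 else C0.
Definition norm2 v : R := rsum (fun i => Cnorm2 (v i)).

End Vectors.

Arguments vzero {I}.

Lemma mat_ext (I : finType) (A B : mat I) : (forall i j, A i j = B i j) -> A = B.
Proof. by move=> AB; do 2!apply: functional_extensionality => ?; exact: AB. Qed.

Ltac vec_ring := apply: functional_extensionality => ?;
  rewrite /vadd /vsub /vscal /vzero; ring.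

Section InnerProduct.
Variable I : finType.
Implicit Types (u v w : vec I) (A B : mat I).

Lemma vnormE v : vnorm v = sqrt (norm2 v). Proof. by []. Qed.

Lemma norm2_ge0 v : 0 <= norm2 v.
Proof. by apply: rsum_ge0 => i; exact: Cnorm2_ge0. Qed.

Lemma vnorm_ge0 v : 0 <= vnorm v. Proof. exact: sqrt_pos. Qed.

Lemma vnorm_sqr v : vnorm v * vnorm v = norm2 v.
Proof. by rewrite sqrt_sqrt //; exact: norm2_ge0. Qed.

Lemma norm2_vzero : norm2 (@vzero I) = 0.
Proof. by apply: rsum_eq0 => i; rewrite /Cnorm2 /=; ring. Qed.

Lemma norm2_eq0 v : norm2 v = 0 -> v = vzero.
Proof.
move=> v0; apply: functional_extensionality => i; apply: Cnorm2_eq0.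
have := @term_le_rsum I _ i (fun j => Cnorm2_ge0 (v j)).
by rewrite -/(norm2 v) v0; have := Cnorm2_ge0 (v i); lra.
Qed.

Lemma norm2_scal c v : norm2 (vscal c v) = Cnorm2 c * norm2 v.
Proof. by rewrite /norm2 -rsumZ; apply: eq_rsum => i; rewrite Cnorm2M. Qed.

Lemma vnorm_eq0_or_gt0 v : vnorm v = 0 \/ 0 < vnorm v.
Proof. by have := vnorm_ge0 v; lra. Qed.

Lemma vnorm_scal (c : R) v : 0 <= c -> vnorm (vscal c%:C v) = c * vnorm v.
Proof.
move=> c0; rewrite !vnormE norm2_scal Cnorm2_real.
by rewrite sqrt_mult ?sqrt_square //; [nra | exact: norm2_ge0].
Qed.

Lemma vscal1 v : vscal C1 v = v.
Proof. by vec_ring. Qed.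

Lemma innerDr u v w : inner u (vadd v w) = (inner u v + inner u w)%Cx.
Proof. by rewrite /inner -csumD; apply: eq_csum => i; rewrite /vadd; ring. Qed.

Lemma innerZr c u v : inner u (vscal c v) = (c * inner u v)%Cx.
Proof. by rewrite /inner -csumZ; apply: eq_csum => i; rewrite /vscal; ring. Qed.

Lemma inner_conj u v : inner v u = ((inner u v)^*)%Cx.
Proof. by rewrite /inner csum_conj; apply: eq_csum => i; rewrite !CconjE; ring. Qed.

Lemma innerDl u v w : inner (vadd v w) u = (inner v u + inner w u)%Cx.
Proof. by rewrite inner_conj innerDr CconjD -!inner_conj. Qed.

Lemma innerZl c u v : inner (vscal c u) v = (c^* * inner u v)%Cx.
Proof. by rewrite inner_conj innerZr CconjM -inner_conj. Qed.

Lemma inner0r u : inner u vzero = C0.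
Proof. by apply: csum_eq0 => i; rewrite /vzero; ring. Qed.

Lemma inner0l u : inner vzero u = C0.
Proof. by rewrite inner_conj inner0r Cconj0. Qed.

Lemma vsubE u v : vsub u v = vadd u (vscal (- C1)%Cx v).
Proof. by vec_ring. Qed.

Lemma innerBr u v w : inner u (vsub v w) = (inner u v - inner u w)%Cx.
Proof. by rewrite vsubE innerDr innerZr; ring. Qed.

Lemma innerBl u v w : inner (vsub v w) u = (inner v u - inner w u)%Cx.
Proof. by rewrite inner_conj innerBr CconjB -!inner_conj. Qed.

Lemma inner_self v : inner v v = ((norm2 v)%:C)%Cx.
Proof.
apply: Cx_eq; rewrite /= /inner ?fst_csum ?snd_csum.
  by apply: eq_rsum => i; rewrite Cconj_mul_self.
by apply: rsum_eq0 => i; rewrite Cconj_mul_self.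
Qed.

Lemma norm2E v : norm2 v = fst (inner v v).
Proof. by rewrite inner_self. Qed.

Lemma Re_inner_sym u v : fst (inner u v) = fst (inner v u).
Proof. by rewrite inner_conj. Qed.

Lemma norm2D u v : norm2 (vadd u v) = norm2 u + 2 * fst (inner u v) + norm2 v.
Proof.
by rewrite norm2E innerDr !innerDl /= (Re_inner_sym v u) -!norm2E; ring.
Qed.

Lemma norm2_sub_scal s u v :
  norm2 (vsub u (vscal s%:C v)) = norm2 u - 2 * s * fst (inner u v) + s * s * norm2 v.
Proof.
rewrite norm2E innerBr !innerBl innerZr !innerZl innerZr Cconj_real /=.
by rewrite (Re_inner_sym v u) -!norm2E; ring.
Qed.

Lemma Re_inner_ge u v : - ((norm2 u + norm2 v) / 2) <= fst (inner u v).
Proof. by have := norm2_ge0 (vadd u v); rewrite norm2D; lra. Qed.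

Lemma Re_inner_le u v : fst (inner u v) <= vnorm u * vnorm v.
Proof.
apply: le_of_quadratic; [exact: vnorm_ge0 | exact: vnorm_ge0 | move=> s _].
rewrite !vnorm_sqr; have := norm2_ge0 (vsub u (vscal s%:C v)).
by rewrite norm2_sub_scal; lra.
Qed.

Lemma Cauchy_Schwarz u v : Cnorm2 (inner u v) <= norm2 u * norm2 v.
Proof.
set a := inner u v.
have a0 := Cnorm2_ge0 a; have n0 := norm2_ge0 u.
suff quad : Cnorm2 a * Cnorm2 a <= Cnorm2 a * (norm2 u * norm2 v).
  have [a_eq0|a_gt0] : Cnorm2 a = 0 \/ 0 < Cnorm2 a by lra.
    by rewrite a_eq0; apply: Rmult_le_pos => //; exact: norm2_ge0.
  exact: Rmult_le_reg_l quad.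
have := Re_inner_le (vscal a u) v.
rewrite innerZl Cconj_mul_self /= => /(fun h => Rmult_le_compat _ _ _ _ a0 a0 h h).
have -> : vnorm (vscal a u) * vnorm v * (vnorm (vscal a u) * vnorm v)
  = (vnorm (vscal a u) * vnorm (vscal a u)) * (vnorm v * vnorm v) by ring.
by rewrite !vnorm_sqr norm2_scal; lra.
Qed.

Lemma csum_mul_delta k (P : I -> Cx) : csum (fun i => P i * delta k i)%Cx = P k.
Proof.
rewrite -[RHS](csum_delta k P); apply: eq_csum => i.
by rewrite /delta; case: eqP => _; ring.
Qed.

Lemma inner_delta k v : inner (delta k) v = v k.
Proof.
rewrite -[RHS](@csum_mul_delta k); apply: eq_csum => i.
by rewrite /delta; case: eqP => _; rewrite ?CconjE; ring.
Qed.

Lemma mulmvD A u v : mulmv A (vadd u v) = vadd (mulmv A u) (mulmv A v).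
Proof.
apply: functional_extensionality => i; rewrite /mulmv /vadd -csumD.
by apply: eq_csum => j; ring.
Qed.

Lemma mulmvZ A c v : mulmv A (vscal c v) = vscal c (mulmv A v).
Proof.
apply: functional_extensionality => i; rewrite /mulmv /vscal -csumZ.
by apply: eq_csum => j; ring.
Qed.

Lemma mulmvB A u v : mulmv A (vsub u v) = vsub (mulmv A u) (mulmv A v).
Proof. by rewrite !vsubE mulmvD mulmvZ. Qed.

Lemma mulmv0 A : mulmv A vzero = vzero.
Proof.
by apply: functional_extensionality => i; apply: csum_eq0 => j; rewrite /vzero; ring.
Qed.

Lemma mulmv_zero_matrix v : mulmv (fun _ _ => C0) v = vzero.
Proof. by apply: functional_extensionality => i; apply: csum_eq0 => j; ring. Qed.

Lemma mulmvA A B v : mulmv (mulmm A B) v = mulmv A (mulmv B v).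
Proof.
apply: functional_extensionality => i; rewrite /mulmv /mulmm.
transitivity (csum (fun j => csum (fun k => A i k * B k j * v j)%Cx)).
  by apply: eq_csum => j; rewrite csumZr.
rewrite csum_exchange; apply: eq_csum => k; rewrite -csumZ.
by apply: eq_csum => j; ring.
Qed.

Lemma mulmv_delta A k : mulmv A (delta k) = fun i => A i k.
Proof. by apply: functional_extensionality => i; exact: csum_mul_delta. Qed.

Lemma mulmv1 v : mulmv (@idmat I) v = v.
Proof.
apply: functional_extensionality => i; rewrite -[RHS](csum_mul_delta i v).
by apply: eq_csum => j; rewrite /idmat /delta eq_sym; ring.
Qed.

Lemma mulmv_inj A B : (forall v, mulmv A v = mulmv B v) -> A = B.
Proof.
move=> AB; apply: mat_ext => i k.
by move: (AB (delta k)); rewrite !mulmv_delta => /(f_equal (fun f => f i)).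
Qed.

Lemma inner_hermitian A u v : hermitian A -> inner u (mulmv A v) = inner (mulmv A u) v.
Proof.
move=> Ah; rewrite /inner /mulmv.
transitivity (csum (fun i => csum (fun j => (u i)^* * (A i j * v j))%Cx)).
  by apply: eq_csum => i; rewrite csumZ.
rewrite csum_exchange; apply: eq_csum => j; rewrite csum_conj -csumZr.
by apply: eq_csum => i; rewrite (Ah i j) !CconjE; ring.
Qed.

Lemma hermitian_msub A B : hermitian A -> hermitian B -> hermitian (msub A B).
Proof. by move=> Ah Bh i j; rewrite /msub (Ah i j) (Bh i j) CconjB. Qed.

Lemma norm2_mulmv_le A v : norm2 (mulmv A v) <= rsum (fun i => norm2 (A i)) * norm2 v.
Proof.
rewrite Rmult_comm -rsumZ; apply: rsum_le => i; rewrite Rmult_comm.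
have -> : norm2 (A i) = norm2 (fun j => (A i j)^*)%Cx.
  by apply: eq_rsum => j; rewrite Cnorm2_conj.
have -> : mulmv A v i = inner (fun j => (A i j)^*)%Cx v.
  by apply: eq_csum => j; rewrite CconjK.
exact: Cauchy_Schwarz.
Qed.

Lemma opnorm_le_of_unit A c :
  (forall v, vnorm v = 1 -> vnorm (mulmv A v) <= c) -> opnorm_le A c.
Proof.
move=> A_unit v; have [v0|v0] := vnorm_eq0_or_gt0 v.
  have -> : v = vzero by apply: norm2_eq0; rewrite -vnorm_sqr v0; ring.
  by rewrite mulmv0 vnormE norm2_vzero sqrt_0; lra.
have iv0 := Rinv_0_lt_compat _ v0.
have w1 : vnorm (vscal (/ vnorm v)%:C v) = 1 by rewrite vnorm_scal; [field |]; lra.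
have := A_unit _ w1; rewrite mulmvZ vnorm_scal; last by lra.
move=> Aw; apply: (Rmult_le_reg_l (/ vnorm v)) => //.
have -> : / vnorm v * (c * vnorm v) = c by field; lra.
exact: Aw.
Qed.

Lemma opnorm_exists A : (exists v : vec I, vnorm v = 1) -> exists r, is_opnorm A r.
Proof.
move=> [v0 v01]; have [||r r_lub] := completeness
  (fun s => exists v : vec I, vnorm v = 1 /\ s = vnorm (mulmv A v)); last by exists r.
- exists (sqrt (rsum (fun i => norm2 (A i)))) => _ [v [v1 ->]].
  apply: sqrt_le_1_alt; have := norm2_mulmv_le A v.
  by rewrite -(vnorm_sqr v) v1 !Rmult_1_r.
- by exists (vnorm (mulmv A v0)), v0.
Qed.

End InnerProduct.

(** * Approximate separation from a convex cone *)

Lemma near_minimizer (T : Type) (K : T -> Prop) (f : T -> R) (e : R) :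
  (exists z, K z) -> (forall z, K z -> 0 <= f z) -> 0 < e ->
  exists2 c, K c & forall z, K z -> f c <= f z + e.
Proof.
move=> [z0 Kz0] f0 e0.
have [||m [ub lub]] := completeness (fun r => exists2 z, K z & r = - f z).
- by exists 0 => _ [z Kz ->]; have := f0 z Kz; lra.
- by exists (- f z0), z0.
have [c Kc fc] : exists2 c, K c & m - e < - f c.
  apply: NNPP => none; have : m <= m - e; last by lra.
  by apply: lub => _ [z Kz ->]; apply: Rnot_lt_le => near; apply: none; exists z.
by exists c => // z Kz; have := ub (- f z) (ex_intro2 _ _ z Kz erefl); lra.
Qed.

Section Cone.
Variable I : finType.
Implicit Types p z c g : vec I.

Definition convex_cone (K : vec I -> Prop) : Prop :=
  [/\ exists z, K z,
      forall y z, K y -> K z -> K (vadd y z)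
    & forall s z, 0 <= s -> K z -> K (vscal s%:C z)].

Lemma ray_nearest_point p z : exists2 s, 0 <= s &
  fst (inner (vsub p (vscal s%:C z)) (vscal s%:C z)) = 0 /\
  norm2 (vsub p (vscal s%:C z)) <= norm2 (vsub p z).
Proof.
have z1 : vsub p z = vsub p (vscal 1%:C z).
  by apply: functional_extensionality => i; rewrite /vsub /vscal; by_coords.
have z0 := norm2_ge0 z.
have orth s : fst (inner (vsub p (vscal s%:C z)) (vscal s%:C z))
    = s * (fst (inner p z) - s * norm2 z).
  by rewrite innerZr innerBl innerZl Cconj_real /= -norm2E; ring.
have [pz|pz] := Rle_lt_dec (fst (inner p z)) 0.
  by exists 0; [lra | rewrite orth z1 !norm2_sub_scal; split; lra].
have {}z0 : 0 < norm2 z.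
  case: z0 => // /esym /norm2_eq0 zE.
  by move: pz; rewrite zE inner0r /=; lra.
have sE : fst (inner p z) = fst (inner p z) / norm2 z * norm2 z by field; lra.
exists (fst (inner p z) / norm2 z); first by apply: Rlt_le; exact: Rdiv_lt_0_compat.
rewrite orth z1 !norm2_sub_scal; move: sE; set s := _ / _ => sE.
rewrite sE; split; first by ring.
by have := Rmult_le_pos _ _ (Rle_0_sqr (s - 1)) (Rlt_le _ _ z0); rewrite /Rsqr; lra.
Qed.

(* The near-minimiser [c] plays the role of the nearest point of the cone, which
   need not be closed; the price is the error term [e * vnorm z]. *)
Lemma cone_separation (K : vec I -> Prop) p m e :
  convex_cone K -> 0 < e -> (forall z, K z -> m <= norm2 (vsub p z)) ->
  exists c, [/\ K c, m <= fst (inner (vsub p c) p)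
    & forall z, K z -> fst (inner (vsub p c) z) <= e * vnorm z].
Proof.
move=> [Kne KD KZ] e0 far; have ee0 : 0 < e * e by nra.
have [c0 Kc0 c0min] :=
  @near_minimizer _ K (fun z => norm2 (vsub p z)) (e * e) Kne (fun z _ => norm2_ge0 _) ee0.
have [s s0 [orth nearer]] := ray_nearest_point p c0.
have Kc := KZ s c0 s0 Kc0; set c := vscal _ c0 in orth nearer Kc.
exists c; split=> // [|z Kz].
  have pE : p = vadd (vsub p c) c by vec_ring.
  by rewrite {2}pE innerDr /= orth -norm2E; have := far c Kc; lra.
apply: le_of_quadratic; [lra | exact: vnorm_ge0 | move=> t t0].
have Kct := KD _ _ Kc (KZ t z (Rlt_le _ _ t0) Kz).
have := c0min _ Kct.
have -> : vsub p (vadd c (vscal t%:C z)) = vsub (vsub p c) (vscal t%:C z) by vec_ring.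
by rewrite norm2_sub_scal vnorm_sqr; lra.
Qed.

End Cone.

(** * The dual of the adversary bound *)

Section Duality.
Variables (X J : finType) (D : J -> X -> X -> bool).
Hypothesis Dsym : forall j x y, D j x y = D j y x.
Hypothesis Dirr : forall j x, D j x x = false.
Hypothesis Dsep : forall x y, x != y -> exists j, D j x y.

Definition mask (j : J) (G : mat X) : mat X := fun x y => if D j x y then G x y else C0.

Definition mconj (G : mat X) : mat X := fun x y => ((G x y)^*)%Cx.

Definition symprod (u v : vec X) : mat X :=
  fun x y => ((1 / 2)%:C * ((u x)^* * v y + (v x)^* * u y))%Cx.

Definition pair_weight (u v : vec X) (x : X) : R := (Cnorm2 (u x) + Cnorm2 (v x)) / 2.

Definition dual_mat (A : finType) (jl : A -> J) (u v : A -> vec X) : mat X :=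
  fun x y => csum (fun a => mask (jl a) (symprod (u a) (v a)) x y).

Definition dual_weight (A : finType) (u v : A -> vec X) (x : X) : R :=
  rsum (fun a => pair_weight (u a) (v a) x).

Definition dual_decomp (M : mat X) (t : X -> R) : Prop :=
  exists (A : finType) (jl : A -> J) (u v : A -> vec X),
    dual_mat jl u v = M /\ dual_weight u v = t.

Lemma pair_weight_ge0 u v x : 0 <= pair_weight u v x.
Proof.
by rewrite /pair_weight; have := Cnorm2_ge0 (u x); have := Cnorm2_ge0 (v x); lra.
Qed.

Lemma mask_diag j G x : mask j G x x = C0.
Proof. by rewrite /mask Dirr. Qed.

Lemma mask_symprod_hermitian j u v : hermitian (mask j (symprod u v)).
Proof.
move=> x y; rewrite /mask Dsym /symprod.
by case: (D j x y); rewrite !CconjE //; ring.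
Qed.

Lemma dual_decomp_hermitian M t : dual_decomp M t -> hermitian M.
Proof.
move=> [A [jl [u [v [<- _]]]]] x y; rewrite /dual_mat csum_conj.
by apply: eq_csum => a; exact: mask_symprod_hermitian.
Qed.

Lemma dual_decomp_diag M t x : dual_decomp M t -> M x x = C0.
Proof. by move=> [A [jl [u [v [<- _]]]]]; apply: csum_eq0 => a; exact: mask_diag. Qed.

Lemma dual_decomp_single j u v : dual_decomp (mask j (symprod u v)) (pair_weight u v).
Proof.
exists unit, (fun=> j), (fun=> u), (fun=> v); split.
  by apply: mat_ext => x y; exact: csum_unit.
by apply: functional_extensionality => x; exact: rsum_unit.
Qed.

Lemma dual_decompD M t N s : dual_decomp M t -> dual_decomp N s ->
  dual_decomp (fun x y => M x y + N x y)%Cx (fun x => t x + s x).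
Proof.
move=> [A [j [u [v [<- <-]]]]] [B [k [u' [v' [<- <-]]]]].
exists (A + B)%type, (sum_rect _ j k), (sum_rect _ u u'), (sum_rect _ v v'); split.
  by apply: mat_ext => x y; exact: csum_sum.
by apply: functional_extensionality => x; exact: rsum_sum.
Qed.

Lemma dual_decompZ c M t : 0 <= c -> dual_decomp M t ->
  dual_decomp (fun x y => c%:C * M x y)%Cx (fun x => c * t x).
Proof.
move=> c0 [A [j [u [v [<- <-]]]]]; have cE := sqrt_sqrt _ c0; set r := sqrt c in cE.
exists A, j, (fun a => vscal r%:C (u a)), (fun a => vscal r%:C (v a)); split.
  apply: mat_ext => x y; rewrite /dual_mat -csumZ; apply: eq_csum => a.
  rewrite /mask /symprod /vscal.
  by case: (D _ _ _); [rewrite -cE RtoCM !CconjE | ]; ring.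
apply: functional_extensionality => x; rewrite /dual_weight -rsumZ.
by apply: eq_rsum => a; rewrite /pair_weight /vscal !Cnorm2M Cnorm2_real cE; field.
Qed.

Definition pair_left (a : X * X) : vec X := delta a.1.
Definition pair_right (F : mat X) (a : X * X) : vec X := vscal (F a.1 a.2) (delta a.2).

Lemma dual_mat_pairs (F : mat X) (jl : X * X -> J) :
  hermitian F -> (forall x, F x x = C0) -> (forall x y, x != y -> D (jl (x, y)) x y) ->
  dual_mat jl pair_left (pair_right F) = F.
Proof.
move=> Fh Fd jlP; apply: mat_ext => x y.
pose half := ((1 / 2)%:C * F x y)%Cx.
transitivity (csum (fun a : X * X => (if a == (x, y) then half else C0)
    + (if a == (y, x) then half else C0))%Cx); last first.
  by rewrite csumD !csum_delta /half; by_coords.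
apply: eq_csum => -[a b].
rewrite /mask /symprod /half /pair_left /pair_right /vscal /delta /= !xpair_eqE.
rewrite (eq_sym a x) (eq_sym a y) (eq_sym b x) (eq_sym b y).
have [<-|xy] := eqVneq x y; first by rewrite Dirr Fd; case: (_ && _); ring.
have yx : y != x by rewrite eq_sym.
have [<-|xa] := eqVneq x a; have [<-|yb] := eqVneq y b; rewrite ?(negPf xy) ?(negPf yx).
- by rewrite jlP // !CconjE /=; ring.
- by case: (D _ _ _); rewrite /= ?CconjE; ring.
- by rewrite andbF /=; case: (D _ _ _); rewrite ?CconjE; ring.
have [<-|ya] := eqVneq y a; have [<-|xb] := eqVneq x b;
  try by case: (D _ _ _); rewrite ?CconjE /=; ring.
by rewrite Dsym jlP // (Fh x y) !CconjE /=; ring.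
Qed.

Lemma dual_weight_pairs_le (F : mat X) x : (forall x y, Cnorm2 (F x y) <= 1) ->
  dual_weight pair_left (pair_right F) x <= INR #|X|.
Proof.
move=> F_le1; pose half (a : X) : R := if a == x then 1 / 2 else 0.
have half_sum : rsum half = 1 / 2 by exact: (rsum_delta x (fun=> 1 / 2)).
apply: (@Rle_trans _ (rsum (fun a : X => rsum (fun b : X => half a + half b)))).
  rewrite /dual_weight rsum_pair; apply: rsum_le => a; apply: rsum_le => b.
  rewrite /pair_weight /pair_left /pair_right /vscal Cnorm2M /delta /half /=.
  rewrite ![_ == x]eq_sym.
  have := F_le1 a b; have := Cnorm2_ge0 (F a b).
  by case: eqP => _; case: eqP => _; rewrite /(Cnorm2 C0) /(Cnorm2 C1) /=; lra.
have -> : rsum (fun a => rsum (fun b => half a + half b))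
    = rsum (fun a => INR #|X| * half a + 1 / 2).
  by apply: eq_rsum => a; rewrite rsumD rsum_const half_sum.
by rewrite rsumD rsumZ half_sum rsum_const; lra.
Qed.

Lemma dual_decomp_small (j0 : J) (F : mat X) (e : R) :
  hermitian F -> (forall x, F x x = C0) -> 0 < e ->
  (forall x y, Cnorm2 (F x y) <= e * e) ->
  exists2 t, dual_decomp F t & forall x, t x <= e * INR #|X|.
Proof.
move=> Fh Fd e0 Fe; pose scaledF : mat X := fun x y => ((/ e)%:C * F x y)%Cx.
have FE : F = fun x y => (e%:C * scaledF x y)%Cx.
  by apply: mat_ext => x y; rewrite /scaledF; by_coords.
pose jl (a : X * X) := odflt j0 [pick j | D j a.1 a.2].
have jlP x y : x != y -> D (jl (x, y)) x y.
  move=> xy; rewrite /jl /=; case: pickP => //= none.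
  by have [j] := Dsep xy; rewrite none.
exists (fun x => e * dual_weight pair_left (pair_right scaledF) x) => [|x].
  rewrite {1}FE; apply: dual_decompZ; first lra.
  exists (X * X)%type, jl, pair_left, (pair_right scaledF); split=> //.
  apply: dual_mat_pairs => //.
    by move=> x y; rewrite /scaledF (Fh x y) !CconjE.
  by move=> x; rewrite /scaledF Fd; ring.
apply: Rmult_le_compat_l; first lra.
apply: dual_weight_pairs_le => {}x y; rewrite /scaledF Cnorm2M Cnorm2_real.
apply: (Rmult_le_reg_l (e * e)); first nra.
have -> : e * e * (/ e * / e * Cnorm2 (F x y)) = Cnorm2 (F x y) by field; lra.
by have := Fe x y; lra.
Qed.

(* Decomposed matrices have zero diagonal, so the diagonal is free to carry the
   weights; decompositions then form a cone in a single real inner product space. *)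
Definition tableau (M : mat X) (t : X -> R) : vec (X * X)%type :=
  fun p => if p.1 == p.2 then (t p.1)%:C else M p.1 p.2.

Definition dual_cone (z : vec (X * X)%type) : Prop :=
  exists M t, dual_decomp M t /\ z = tableau M t.

Definition mdot (G M : mat X) : Cx := csum (fun x => csum (fun y => (G x y)^* * M x y)%Cx).

Lemma tableau_sub M t N s : vsub (tableau M t) (tableau N s)
  = tableau (msub M N) (fun x => t x - s x).
Proof.
apply: functional_extensionality => -[x y]; rewrite /vsub /tableau /=.
by case: eqP => _ //; by_coords.
Qed.

Lemma inner_tableau G s M t : (forall x, M x x = C0) ->
  fst (inner (tableau G s) (tableau M t)) = fst (mdot G M) + rsum (fun x => s x * t x).
Proof.
move=> Md; rewrite /inner csum_pair.
have -> : rsum (fun x => s x * t x) = fst (csum (fun x => (s x)%:C * (t x)%:C)%Cx).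
  by rewrite fst_csum; apply: eq_rsum => x /=; ring.
rewrite -[fst _ + fst _]/(fst (_ + _)%Cx) -csumD; congr fst.
apply: eq_csum => x; rewrite -(csum_delta x (fun=> (s x)%:C * (t x)%:C)%Cx) -csumD.
apply: eq_csum => y; rewrite /tableau /= eq_sym.
by have [->|_] := eqVneq y x; rewrite ?Md ?CconjE; ring.
Qed.

Lemma dual_cone_convex : convex_cone dual_cone.
Proof.
split.
- exists (tableau (fun _ _ => C0) (fun=> 0)), (fun _ _ => C0), (fun=> 0); split=> //.
  exists void, (of_void _), (of_void _), (of_void _); split.
    by apply: mat_ext => x y; apply: csum_eq0; case.
  by apply: functional_extensionality => x; apply: rsum_eq0; case.
- move=> _ _ [M [t [Mt ->]]] [N [s [Ns ->]]].
  exists (fun x y => M x y + N x y)%Cx, (fun x => t x + s x); split.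
    exact: dual_decompD.
  apply: functional_extensionality => -[x y]; rewrite /vadd /tableau /=.
  by case: eqP => _ //; by_coords.
- move=> c _ c0 [M [t [Mt ->]]].
  exists (fun x y => c%:C * M x y)%Cx, (fun x => c * t x); split.
    exact: dual_decompZ.
  apply: functional_extensionality => -[x y]; rewrite /vscal /tableau /=.
  by case: eqP => _ //; by_coords.
Qed.

Lemma Cnorm2_symprod_le u v x y :
  Cnorm2 (symprod u v x y) <= pair_weight u v x * pair_weight u v y.
Proof.
rewrite /symprod /pair_weight /Cnorm2.
move: (u x) (u y) (v x) (v y) => [a b] [c d] [e f] [g h] /=.
(* Lagrange's identity: the two sides differ by [|u x * u y - v x * v y|^2 / 4]. *)
have := Rle_0_sqr (a * c - b * d - e * g + f * h).
have := Rle_0_sqr (a * d + b * c - e * h - f * g).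
rewrite /Rsqr; lra.
Qed.

Lemma vnorm_tableau_single_le j u v :
  vnorm (tableau (mask j (symprod u v)) (pair_weight u v)) <= rsum (pair_weight u v).
Proof.
have w0 := rsum_ge0 (pair_weight_ge0 u v).
rewrite -[rsum _]sqrt_square // vnormE; apply: sqrt_le_1_alt.
rewrite -rsumZ /norm2 rsum_pair; apply: rsum_le => x; rewrite Rmult_comm -rsumZ.
apply: rsum_le => y; rewrite /tableau /=.
have [<-|_] := eqVneq x y; first by rewrite Cnorm2_real; lra.
have := Cnorm2_symprod_le u v x y; have := pair_weight_ge0 u v x.
have := pair_weight_ge0 u v y; rewrite /mask; case: (D _ _ _) => // *.
by rewrite /Cnorm2 /=; nra.
Qed.

Lemma Re_mdot_symprod j (G : mat X) u v : hermitian G ->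
  fst (mdot G (mask j (symprod u v)))
  = fst (inner u (mulmv (mask j (mconj G)) v)).
Proof.
move=> Gh; set S := inner u _.
have SE : S = csum (fun x => csum (fun y =>
    (u x)^* * (mask j (mconj G) x y * v y))%Cx).
  by apply: eq_csum => x; rewrite -csumZ.
suff -> : mdot G (mask j (symprod u v)) = ((1 / 2)%:C * (S + S^*))%Cx by rewrite /=; lra.
have SC : (S^*)%Cx = csum (fun x => csum (fun y =>
    (v x)^* * (mask j (mconj G) x y * u y))%Cx).
  rewrite SE csum_conj csum_exchange; apply: eq_csum => x; rewrite csum_conj.
  apply: eq_csum => y; rewrite /mask /mconj (Dsym j y x).
  by case: (D _ _ _); rewrite ?(Gh x y) !CconjE; ring.
rewrite SC SE -csumD -csumZ; apply: eq_csum => x; rewrite -csumD -csumZ.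
by apply: eq_csum => y; rewrite /mask /mconj /symprod; case: (D _ _ _); ring.
Qed.

Definition feasible (G : mat X) : Prop :=
  hermitian G /\ forall j, opnorm_le (mask j G) 1.

Definition dominates (b : X -> R) (G : mat X) : Prop := forall j u v,
  fst (mdot G (mask j (symprod u v))) <= rsum (fun x => b x * pair_weight u v x).

(* The separating functional is an unnormalised adversary matrix [G] with weights [b];
   conjugation by [b^(-1/2)] makes it feasible, and testing the feasible matrix on the
   vector [b^(1/2)] recovers the pairing with [G]. *)
Definition normalize (b : X -> R) (G : mat X) : mat X :=
  fun x y => ((/ sqrt (b x))%:C * (/ sqrt (b y))%:C * (G x y)^*)%Cx.

Lemma normalize_feasible (b : X -> R) (G : mat X) :
  hermitian G -> (forall x, 0 < b x) -> dominates b G -> feasible (normalize b G).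
Proof.
move=> Gh b0 bG; split=> [x y|j v]; first by rewrite /normalize (Gh x y) !CconjE; ring.
rewrite Rmult_1_l !vnormE; apply: sqrt_le_1_alt; set u := mulmv _ v.
pose rescale (w : vec X) : vec X := fun x => ((/ sqrt (b x))%:C * w x)%Cx.
have weightE w w' : rsum (fun x => b x * pair_weight (rescale w) (rescale w') x)
    = (norm2 w + norm2 w') / 2.
  rewrite [RHS]Rmult_comm /norm2 -rsumD -rsumZ; apply: eq_rsum => x.
  have s0 := sqrt_lt_R0 _ (b0 x).
  rewrite /pair_weight /rescale !Cnorm2M Cnorm2_real -{1}(sqrt_sqrt (b x)); last first.
    by have := b0 x; lra.
  by field; lra.
have := bG j (rescale u) (rescale v); rewrite Re_mdot_symprod // weightE.
have -> : inner (rescale u) (mulmv (mask j (mconj G)) (rescale v)) = inner u u.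
  apply: eq_csum => x; rewrite {1}/rescale CconjM Cconj_real.
  rewrite [LHS](_ : _ = (u x)^* * ((/ sqrt (b x))%:C *
    mulmv (mask j (mconj G)) (rescale v) x))%Cx; last by ring.
  congr Cmul; rewrite /u /mulmv -csumZ; apply: eq_csum => y.
  by rewrite /rescale /normalize /mask /mconj; case: (D _ _ _); ring.
by rewrite -norm2E; lra.
Qed.

Section StrongDuality.
Variables (E : mat X) (W : R).
Hypothesis E_hermitian : hermitian E.
Hypothesis E_diag : forall x, E x x = C0.
Hypothesis W_ge0 : 0 <= W.
Hypothesis W_bound : forall G, feasible G -> opnorm_le (hadamard G E) W.

Let target : vec (X * X)%type := tableau E (fun=> W).

Lemma adversary_form_le (G : mat X) v : feasible G ->
  fst (inner v (mulmv (hadamard G E) v)) <= W * norm2 v.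
Proof.
move=> Gfeas; apply: Rle_trans (Re_inner_le _ _) _; rewrite -vnorm_sqr.
have -> : W * (vnorm v * vnorm v) = vnorm v * (W * vnorm v) by ring.
by apply: Rmult_le_compat_l; [exact: vnorm_ge0 | exact: W_bound].
Qed.

Lemma weighted_adversary_bound (G : mat X) (b : X -> R) :
  hermitian G -> (forall x, 0 < b x) -> dominates b G -> fst (mdot G E) <= W * rsum b.
Proof.
move=> Gh b0 bG; pose r : vec X := fun x => (sqrt (b x))%:C.
have := adversary_form_le r (normalize_feasible Gh b0 bG).
have -> : norm2 r = rsum b.
  by apply: eq_rsum => x; rewrite Cnorm2_real sqrt_sqrt //; have := b0 x; lra.
rewrite (_ : inner r _ = mdot G E) //.
apply: eq_csum => x; rewrite -csumZ; apply: eq_csum => y.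
rewrite /hadamard /normalize /r Cconj_real.
have rV z : ((sqrt (b z))%:C * (/ sqrt (b z))%:C = C1)%Cx.
  by rewrite -RtoCM Rinv_r //; have := sqrt_lt_R0 _ (b0 z); lra.
transitivity (((sqrt (b x))%:C * (/ sqrt (b x))%:C) * ((sqrt (b y))%:C * (/ sqrt (b y))%:C)
  * ((G x y)^* * E x y))%Cx; first by ring.
by rewrite !rV; ring.
Qed.

Lemma target_separation m e : 0 < e ->
  (forall z, dual_cone z -> m <= norm2 (vsub target z)) ->
  exists (G : mat X) (b : X -> R),
    [/\ hermitian G, m + W * rsum b <= fst (mdot G E) & dominates (fun x => b x + e) G].
Proof.
move=> e0 far.
have [_ [[M [t [Mt ->]]] gp gz]] := cone_separation dual_cone_convex e0 far.
move: gp gz; rewrite {1 2}/target tableau_sub; set G := msub E M; set s := fun x => W - t x.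
have Gh : hermitian G := hermitian_msub E_hermitian (dual_decomp_hermitian Mt).
move=> gp gz; exists G, (fun x => - s x); split=> //.
  have := gp; rewrite /target inner_tableau //.
  have -> : rsum (fun x => s x * W) = - (W * rsum (fun x => - s x)).
    by rewrite [RHS]Ropp_mult_distr_l -rsumZ; apply: eq_rsum => x; ring.
  by lra.
move=> j u v.
have := gz _ (ex_intro _ _ (ex_intro _ _ (conj (dual_decomp_single j u v) erefl))).
rewrite inner_tableau; last by move=> x; exact: mask_diag.
have := Rmult_le_compat_l _ _ _ (Rlt_le _ _ e0) (vnorm_tableau_single_le j u v).
have -> : rsum (fun x => (- s x + e) * pair_weight u v x)
  = e * rsum (pair_weight u v) + - 1 * rsum (fun x => s x * pair_weight u v x).
  by rewrite -!rsumZ -rsumD; apply: eq_rsum => x; ring.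
by lra.
Qed.

Lemma target_not_separated (j0 : J) m : 0 < m ->
  ~ (forall z, dual_cone z -> m <= norm2 (vsub target z)).
Proof.
move=> m0 far; have X0 : 0 <= W * INR #|X| by apply: Rmult_le_pos (pos_INR _).
pose e := m / (2 * (W * INR #|X|) + 1).
have e0 : 0 < e by apply: Rdiv_lt_0_compat; lra.
have eE : e * (2 * (W * INR #|X|) + 1) = m by rewrite /e; field; lra.
have [G [b [Gh Gm Gb]]] := target_separation e0 far.
have be0 x : 0 <= b x + e.
  have := Gb j0 (delta x) (delta x); rewrite Re_mdot_symprod // inner_delta mulmv_delta.
  rewrite mask_diag -[b x + e](rsum_delta x (fun y => b y + e)).
  rewrite (@eq_rsum _ _ (fun y => if y == x then b y + e else 0)) // => y.
  rewrite /pair_weight /delta.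
  by case: eqP => _; rewrite /Cnorm2 /=; field.
have : fst (mdot G E) <= W * rsum (fun x => b x + 2 * e).
  apply: weighted_adversary_bound => // [x|j u v]; first by have := be0 x; lra.
  apply: Rle_trans (Gb j u v) _; apply: rsum_le => x.
  by apply: Rmult_le_compat_r; [exact: pair_weight_ge0 | lra].
by rewrite rsumD rsum_const; lra.
Qed.

Lemma target_approximation (M : mat X) t e : dual_decomp M t -> 0 < e ->
  norm2 (vsub target (tableau M t)) <= e * e ->
  (forall x y, Cnorm2 (msub E M x y) <= e * e) /\ (forall x, t x <= W + e).
Proof.
move=> Mt e0; rewrite tableau_sub => close.
have entry p : Cnorm2 (tableau (msub E M) (fun x => W - t x) p) <= e * e.
  apply: Rle_trans close; apply: (term_le_rsum p (F := fun p => Cnorm2 _)) => q.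
  exact: Cnorm2_ge0.
split=> [x y|x].
  have := entry (x, y); rewrite /tableau /=; have [<- _|//] := eqVneq x y.
  rewrite /msub E_diag (dual_decomp_diag x Mt) (_ : C0 - C0 = C0)%Cx; last by ring.
  by rewrite Cnorm2_real; nra.
have := entry (x, x); rewrite /tableau /= eqxx Cnorm2_real; nra.
Qed.

Lemma adversary_strong_duality (j0 : J) d : 0 < d ->
  exists2 t, dual_decomp E t & forall x, t x <= W + d.
Proof.
move=> d0; have X0 := pos_INR #|X|.
pose e := d / (INR #|X| + 1).
have e0 : 0 < e by apply: Rdiv_lt_0_compat; lra.
have eE : e * (INR #|X| + 1) = d by rewrite /e; field; lra.
have [M [t [Mt close]]] : exists M t, dual_decomp M t /\
    norm2 (vsub target (tableau M t)) <= e * e.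
  apply: NNPP => none; apply: (@target_not_separated j0 (e * e)); first by nra.
  move=> _ [M [t [Mt ->]]]; apply: Rnot_lt_le => lt.
  by apply: none; exists M, t; split=> //; lra.
have [entries weights] := target_approximation Mt e0 close.
have [||s Fs sle] := @dual_decomp_small j0 (msub E M) e _ _ e0 entries.
- exact: hermitian_msub (dual_decomp_hermitian Mt).
- by move=> x; rewrite /msub E_diag (dual_decomp_diag x Mt); ring.
exists (fun x => t x + s x); last by move=> x; have := weights x; have := sle x; lra.
have -> : E = fun x y => (M x y + msub E M x y)%Cx.
  by apply: mat_ext => x y; rewrite /msub; ring.
exact: dual_decompD.
Qed.

End StrongDuality.
End Duality.

(** * The adversary bound *)

Lemma is_lub_inhabited (P : R -> Prop) m : is_lub P m -> exists r, P r.
Proof.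
move=> [_ lub]; apply: NNPP => none; have : m <= m - 1; last by lra.
by apply: lub => r Pr; case: none; exists r.
Qed.

Lemma unit_gram_hermitian (I : finType) (rho : mat I) : unit_gram rho -> hermitian rho.
Proof. by move=> [m [v [_ gram]]] x y; rewrite !gram inner_conj. Qed.

Lemma unit_gram_diag (I : finType) (rho : mat I) x : unit_gram rho -> rho x x = C1.
Proof. by move=> [m [v [v1 gram]]]; rewrite gram inner_self -vnorm_sqr v1; by_coords. Qed.

Section Adversary.
Variables (S : finType) (n : nat) (X : {set n.-tuple S}) (rho sigma : mat (Xidx X)).
Variable adv : R.
Hypothesis adv_lub : is_Adv rho sigma adv.

Definition differ (j : 'I_n) (x y : Xidx X) : bool := tnth (val x) j != tnth (val y) j.

Lemma hadamard_Delta (G : mat (Xidx X)) j : hadamard G (@Delta _ _ X j) = mask differ j G.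
Proof.
apply: mat_ext => x y.
by rewrite /hadamard /Delta /mask /differ; case: eqP => _ /=; ring.
Qed.

Lemma Adv_ge0 : 0 <= adv.
Proof.
have [r [G [Gfeas r_lub]]] := is_lub_inhabited adv_lub.
have [s [v [v1 sE]]] := is_lub_inhabited r_lub.
apply: (@Rle_trans _ s); first by rewrite sE; exact: vnorm_ge0.
apply: (@Rle_trans _ r); first by apply: (proj1 r_lub); exists v.
by apply: (proj1 adv_lub); exists G.
Qed.

Lemma opnorm_le_Adv (G : mat (Xidx X)) : adv_feasible G ->
  opnorm_le (hadamard G (msub rho sigma)) adv.
Proof.
move=> Gfeas; apply: opnorm_le_of_unit => v v1.
have [r r_opnorm] := opnorm_exists (hadamard G (msub rho sigma)) (ex_intro _ _ v1).
apply: (@Rle_trans _ r); first by apply: (proj1 r_opnorm); exists v.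
by apply: (proj1 adv_lub); exists G.
Qed.

Lemma Adv_dual d : (1 <= n)%N -> unit_gram rho -> unit_gram sigma -> 0 < d ->
  exists2 t, dual_decomp differ (msub rho sigma) t & forall x, t x <= adv + d.
Proof.
move=> n0 rho1 sigma1; apply: adversary_strong_duality => //.
- by move=> j x y; rewrite /differ eq_sym.
- by move=> j x; rewrite /differ eqxx.
- move=> x y xy; apply: NNPP => same; case/eqP: xy; apply: val_inj.
  apply: eq_from_tnth => j; apply/eqP/negPn/negP => xyj.
  by apply: same; exists j.
- by apply: hermitian_msub; exact: unit_gram_hermitian.
- by move=> x; rewrite /msub !unit_gram_diag //; ring.
- exact: Adv_ge0.
- move=> G [Gh Gj]; apply: opnorm_le_Adv; split=> // j.
  by rewrite hadamard_Delta; exact: Gj.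
- exact: (Ordinal n0).
Qed.

End Adversary.

(** * Gluing evolutions in time *)

Definition glue (A : Type) (b : R) (f g : R -> A) (t : R) : A :=
  if Rle_dec t b then f t else g t.

Lemma glue_le (A : Type) b (f g : R -> A) t : t <= b -> glue b f g t = f t.
Proof. by rewrite /glue; case: Rle_dec. Qed.

Lemma glue_gt (A : Type) b (f g : R -> A) t : b < t -> glue b f g t = g t.
Proof. by rewrite /glue; case: Rle_dec => // tb bt; lra. Qed.

Lemma comp_glue (A B : Type) (h : A -> B) b (f g : R -> A) :
  (fun t => h (glue b f g t)) = glue b (fun t => h (f t)) (fun t => h (g t)).
Proof. by apply: functional_extensionality => t; rewrite /glue; case: Rle_dec. Qed.

Definition continuous_on (f : R -> R) (a b : R) : Prop :=
  forall t, a <= t <= b -> limit1_in f (fun s => a <= s <= b) (f t) t.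

Lemma continuity_continuous_on f a b : continuity f -> continuous_on f a b.
Proof.
move=> fc t _ eps eps0; have [d [d0 near]] := fc t eps eps0.
exists d; split=> // s [_ st].
have [<-|ts] := Req_dec t s; first by rewrite /= Rdist_eq; lra.
by apply: near; split=> //; split.
Qed.

Lemma continuous_on_glue (f g : R -> R) a b c : a <= b <= c -> f b = g b ->
  continuous_on f a b -> continuous_on g b c -> continuous_on (glue b f g) a c.
Proof.
move=> abc fgb fc gc t tac eps eps0.
have glueE s : glue b f g s = f (Rmin s b) + g (Rmax s b) - f b.
  rewrite /glue; case: Rle_dec => sb.
    by rewrite Rmin_left ?Rmax_right // fgb /=; ring.
  by rewrite Rmin_right ?Rmax_left /=; lra.
have minP s : a <= s <= c -> a <= Rmin s b <= b by rewrite /Rmin; case: Rle_dec; lra.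
have maxP s : a <= s <= c -> b <= Rmax s b <= c by rewrite /Rmax; case: Rle_dec; lra.
have eps2 : eps / 2 > 0 by lra.
have [d1 [d10 near1]] := fc _ (minP t tac) _ eps2.
have [d2 [d20 near2]] := gc _ (maxP t tac) _ eps2.
exists (Rmin d1 d2); split=> [|s [sac st]]; first exact: Rmin_pos.
have st1 := Rlt_le_trans _ _ _ st (Rmin_l _ _).
have st2 := Rlt_le_trans _ _ _ st (Rmin_r _ _).
move: near1 near2 st1 st2; rewrite /= /Rdist => near1 near2 st1 st2.
have f_near : Rabs (f (Rmin s b) - f (Rmin t b)) < eps / 2.
  apply: near1; split; first exact: minP.
  by apply: Rle_lt_trans st1; rewrite /Rmin; do 2!case: Rle_dec; split_Rabs; lra.
have g_near : Rabs (g (Rmax s b) - g (Rmax t b)) < eps / 2.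
  apply: near2; split; first exact: maxP.
  by apply: Rle_lt_trans st2; rewrite /Rmax; do 2!case: Rle_dec; split_Rabs; lra.
by rewrite !glueE; move: f_near g_near; split_Rabs; lra.
Qed.

Definition Ccontinuous_on (f : R -> Cx) (a b : R) : Prop :=
  continuous_on (fun s => fst (f s)) a b /\ continuous_on (fun s => snd (f s)) a b.

Definition Cderivable_lim (f : R -> Cx) (t : R) (l : Cx) : Prop :=
  derivable_pt_lim (fun s => fst (f s)) t (fst l) /\
  derivable_pt_lim (fun s => snd (f s)) t (snd l).

Definition Cpw_cont (f : R -> Cx) (a b : R) : Prop :=
  pw_cont (fun s => fst (f s)) a b /\ pw_cont (fun s => snd (f s)) a b.

Lemma Ccontinuous_on_glue (f g : R -> Cx) a b c : a <= b <= c -> f b = g b ->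
  Ccontinuous_on f a b -> Ccontinuous_on g b c -> Ccontinuous_on (glue b f g) a c.
Proof.
move=> abc fgb [f1 f2] [g1 g2]; rewrite /Ccontinuous_on !(comp_glue fst) !(comp_glue snd).
by split; apply: continuous_on_glue; rewrite // fgb.
Qed.

Lemma Cderivable_lim_locally_ext (f g : R -> Cx) t a b l : a < t < b ->
  (forall s, a < s < b -> f s = g s) -> Cderivable_lim f t l -> Cderivable_lim g t l.
Proof.
move=> tab fg [f1 f2]; split; [apply: derivable_pt_lim_locally_ext f1 |
  apply: derivable_pt_lim_locally_ext f2]; try exact: tab; by move=> s /fg ->.
Qed.

Lemma Cderivable_continuous_on (f : R -> Cx) a b :
  (forall t, exists l, Cderivable_lim f t l) -> Ccontinuous_on f a b.
Proof.
move=> df; split; apply: continuity_continuous_on => t; have [l [d1 d2]] := df t;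
  apply: derivable_continuous_pt; eexists; [exact: d1 | exact: d2].
Qed.

Lemma pw_cont_const (c a b : R) : a < b -> pw_cont (fun=> c) a b.
Proof.
move=> ab; exists 1%N, (fun i => if i is 0%N then a else b); do 3!split=> //; case=> // _.
by exists (fun=> c); split=> //; exact: continuity_const.
Qed.

Lemma pw_cont_point (f : R -> R) a : pw_cont f a a.
Proof. by exists 0%N, (fun=> a). Qed.

Lemma breakpoints_le (k : nat) (pts : nat -> R) i j :
  (forall m, (m < k)%N -> pts m < pts m.+1) -> (i <= j <= k)%N -> pts i <= pts j.
Proof.
move=> incr; elim: j => [|j IH]; first by case: i => // _; lra.
rewrite leq_eqVlt => /andP [/orP [/eqP -> _|]]; first lra.
rewrite ltnS => ij jk; have := incr j jk.
by have := IH (introT andP (conj ij (ltnW jk))); lra.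
Qed.

Lemma pw_cont_glue (f g : R -> R) a b c :
  pw_cont f a b -> pw_cont g b c -> pw_cont (glue b f g) a c.
Proof.
move=> [k [p [pa [pb [pinc pf]]]]] [l [q [qb [qc [qinc qg]]]]].
exists (k + l)%N, (fun i => if (i <= k)%N then p i else q (i - k)%N).
have late i : (k <= i)%N -> (if (i <= k)%N then p i else q (i - k)%N) = q (i - k)%N.
  by move=> ki; case: leqP => // ik; rewrite (@anti_leq i k) ?ki ?ik // subnn pb qb.
split; first by [].
split; first by rewrite late ?leq_addr // addKn.
split=> i ikl; have [ik|ki] := ltnP i k.
- by rewrite (ltnW ik); exact: pinc.
- by rewrite late //= subSn //; apply: qinc; rewrite ltn_subLR.
- rewrite (ltnW ik); have [h [hc fh]] := pf i ik; exists h; split=> // t tp.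
  rewrite glue_le ?fh //.
  by have := breakpoints_le pinc (introT andP (conj ik (leqnn k))); lra.
- have il : (i - k < l)%N by rewrite ltn_subLR.
  rewrite late //= subSn //.
  have [h [hc gh]] := qg _ il; exists h; split=> // t tq; rewrite glue_gt ?gh //.
  by have := breakpoints_le qinc (introT andP (conj (leq0n (i - k)) (ltnW il))); lra.
Qed.

Lemma Cpw_cont_glue (f g : R -> Cx) a b c :
  Cpw_cont f a b -> Cpw_cont g b c -> Cpw_cont (glue b f g) a c.
Proof.
move=> [f1 f2] [g1 g2]; rewrite /Cpw_cont !(comp_glue fst) !(comp_glue snd).
by split; apply: pw_cont_glue.
Qed.

Section Evolution.
Variable I : finType.
Implicit Types (H K U V : R -> mat I) (P : mat I).

Definition evolves H U (a b : R) : Prop :=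
  (forall p q, Ccontinuous_on (fun s => U s p q) a b) /\
  (exists bad : list R, forall t, a < t < b -> ~ List.In t bad -> forall p q,
      Cderivable_lim (fun s => U s p q) t (- Ci * mulmm (H t) (U t) p q)%Cx).

Lemma generatedE H T U : generated H T U <-> U 0 = @idmat I /\ evolves H U 0 T.
Proof.
split=> [[U0 [Uc Ud]] | [U0 [Uc Ud]]]; do 2!split=> //.
  by move=> p q; split=> t tT; have [] := Uc t tT p q.
by move=> t tT p q; have [U1 U2] := Uc p q; split; [exact: U1 | exact: U2].
Qed.

Lemma evolves_glue H K U V a b c : a <= b <= c -> U b = V b ->
  evolves H U a b -> evolves K V b c -> evolves (glue b H K) (glue b U V) a c.
Proof.
move=> abc UVb [Uc [badU Ud]] [Vc [badV Vd]]; split=> [p q|].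
  rewrite (comp_glue (fun M : mat I => M p q)).
  by apply: Ccontinuous_on_glue; rewrite // UVb.
exists (b :: badU ++ badV)%list => t tac tbad p q.
have tb : t <> b by move=> tb; apply: tbad; left.
have tU : ~ List.In t badU by move=> tIn; apply: tbad; right; apply/List.in_or_app; left.
have tV : ~ List.In t badV by move=> tIn; apply: tbad; right; apply/List.in_or_app; right.
have [ltb|bt] : t < b \/ b < t by lra.
  have tab : a < t < b by lra.
  rewrite !glue_le; try lra; apply: (Cderivable_lim_locally_ext tab _ (Ud t tab tU p q)).
  by move=> s sab; rewrite glue_le //; lra.
have tbc : b < t < c by lra.
rewrite !glue_gt //; apply: (Cderivable_lim_locally_ext tbc _ (Vd t tbc tV p q)).
by move=> s sbc; rewrite glue_gt //; lra.
Qed.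

Definition isometry P : Prop := forall u v, inner (mulmv P u) (mulmv P v) = inner u v.

Definition projection P : Prop :=
  hermitian P /\ forall v, mulmv P (mulmv P v) = mulmv P v.

Definition phase (th : R) : Cx := (cos th, - sin th).

Lemma phase_unitary th : ((phase th)^* * phase th = C1)%Cx.
Proof.
have := sin2_cos2 th; rewrite /Rsqr => sc.
by rewrite Cconj_mul_self /Cnorm2 /RtoC /C1 /=; congr pair; lra.
Qed.

(* [exp (- i th P)] for a projection [P]. *)
Definition propagator P (th : R) : mat I :=
  fun p q => (@idmat I p q + (phase th - C1) * P p q)%Cx.

Lemma mulmv_propagator P th v :
  mulmv (propagator P th) v = vadd v (vscal (phase th - C1)%Cx (mulmv P v)).
Proof.
rewrite -{2}(mulmv1 v); apply: functional_extensionality => i.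
rewrite /vadd /vscal /mulmv /propagator -csumZ -csumD.
by apply: eq_csum => j; ring.
Qed.

Lemma mulmm_propagator P (B : mat I) th p q :
  mulmm (propagator P th) B p q = (B p q + (phase th - C1) * mulmm P B p q)%Cx.
Proof. exact: (f_equal (fun f => f p) (mulmv_propagator P th (fun k => B k q))). Qed.

Lemma propagator0 P : propagator P 0 = @idmat I.
Proof.
apply: mulmv_inj => v; rewrite mulmv_propagator mulmv1.
apply: functional_extensionality => i; rewrite /vadd /vscal /phase sin_0 cos_0.
by by_coords.
Qed.

Lemma propagator_isometry P th : projection P -> isometry (propagator P th).
Proof.
move=> [Ph PP] u v; rewrite !mulmv_propagator !(innerDl, innerDr, innerZl, innerZr).
rewrite -(inner_hermitian u (mulmv P v) Ph) -(inner_hermitian u v Ph) PP !CconjE.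
by ring [(phase_unitary th)].
Qed.

Lemma mulmm_projection_propagator P (B : mat I) th p q : projection P ->
  mulmm P (mulmm (propagator P th) B) p q = (phase th * mulmm P B p q)%Cx.
Proof.
move=> [_ PP]; rewrite -[LHS]/(mulmv P (fun k => mulmm (propagator P th) B k q) p).
rewrite -[mulmm P B p q]/(mulmv P (fun k => B k q) p).
rewrite (_ : (fun k => _) = mulmv (propagator P th) (fun k => B k q)) //.
by rewrite mulmv_propagator mulmvD mulmvZ PP /vadd /vscal; ring.
Qed.

Lemma derivable_phase_combination (x y1 y2 a c t : R) :
  derivable_pt_lim
    (fun s => x + (cos (c * (s - a)) - 1) * y1 + sin (c * (s - a)) * y2) t
    (c * (- sin (c * (t - a)) * y1 + cos (c * (t - a)) * y2)).
Proof. by apply/is_derive_Reals; auto_derive => //; rewrite /Rminus; ring. Qed.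

Lemma derivable_propagator P (V : mat I) (a c t : R) p q : projection P ->
  let U s := mulmm (propagator P (c * (s - a))) V in
  Cderivable_lim (fun s => U s p q) t
    (- Ci * mulmm (fun p q => Cscal c (P p q)) (U t) p q)%Cx.
Proof.
move=> Pproj U; set l := Cmul _ _.
have lE : l = (- Ci * (c%:C * (phase (c * (t - a)) * mulmm P V p q)))%Cx.
  rewrite /l -mulmm_projection_propagator //; congr Cmul; rewrite -csumZ.
  by apply: eq_csum => k; rewrite CscalE /U; ring.
case E : (mulmm P V p q) => [y1 y2]; rewrite lE E; split.
  have := derivable_phase_combination (fst (V p q)) y1 y2 a c t.
  rewrite (_ : _ * _ = fst (- Ci * (c%:C * (phase (c * (t - a)) * (y1, y2))))%Cx);
    last by rewrite /=; ring.
  by apply: derivable_pt_lim_ext => s; rewrite /U mulmm_propagator E /=; ring.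
have := derivable_phase_combination (snd (V p q)) y2 (- y1) a c t.
rewrite (_ : _ * _ = snd (- Ci * (c%:C * (phase (c * (t - a)) * (y1, y2))))%Cx);
  last by rewrite /=; ring.
by apply: derivable_pt_lim_ext => s; rewrite /U mulmm_propagator E /=; ring.
Qed.

Lemma evolves_propagator P (V : mat I) (a b c : R) : projection P ->
  evolves (fun _ p q => Cscal c (P p q))
    (fun s => mulmm (propagator P (c * (s - a))) V) a b.
Proof.
move=> Pproj; split=> [p q|].
  by apply: Cderivable_continuous_on => t; eexists; exact: derivable_propagator.
by exists nil => t _ _ p q; exact: derivable_propagator.
Qed.

End Evolution.

Section Reachable.
Variables (S : finType) (n : nat) (X : {set n.-tuple S}) (w d : nat).
Notation I := (Idx S n w d).

Definition reachable (T : R) (V : Xidx X -> mat I) : Prop :=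
  exists (HD : R -> mat I) (alpha : R -> R) (U : Xidx X -> R -> mat I),
    [/\ 0 <= T /\ forall t, 0 <= t <= T -> hermitian (HD t) /\ Rabs (alpha t) <= 1,
        forall p q, Cpw_cont (fun t => HD t p q) 0 T,
        forall x, generated (Hx HD alpha (val x)) T (U x)
      & forall x, U x T = V x /\ isometry (V x)].

Lemma reachable0 : reachable 0 (fun=> @idmat I).
Proof.
exists (fun _ _ _ => C0), (fun=> 0), (fun _ _ => @idmat I); split.
- by split=> [|t _]; [lra | split; [move=> p q; rewrite Cconj0 | rewrite Rabs_R0; lra]].
- by move=> p q; split; exact: pw_cont_point.
- move=> x; apply/generatedE; split=> //; split=> [p q|]; last by exists nil => t; lra.
  by split; apply: continuity_continuous_on; exact: continuity_const.
- by move=> x; split=> // u v; rewrite !mulmv1.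
Qed.

Lemma reachable_step T V tau K a c (P : Xidx X -> mat I) :
  reachable T V -> 0 < tau -> hermitian K -> Rabs a <= 1 -> (forall x, projection (P x)) ->
  (forall x p q, (K p q + Cscal a (@HQ S n w d (val x) p q))%Cx = Cscal c (P x p q)) ->
  reachable (T + tau) (fun x => mulmm (propagator (P x) (c * tau)) (V x)).
Proof.
move=> [HD [al [U [[T0 HDal] pw gU UV]]]] tau0 Kh a1 Pproj HE.
pose W x t := mulmm (propagator (P x) (c * (t - T))) (V x).
exists (glue T HD (fun=> K)), (glue T al (fun=> a)), (fun x => glue T (U x) (W x)); split.
- split=> [|t tT]; first lra.
  have [tT'|Tt] := Rle_lt_dec t T; last by rewrite !glue_gt.
  by rewrite !glue_le //; apply: HDal; lra.
- move=> p q; rewrite (comp_glue (fun M : mat I => M p q)).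
  by apply: Cpw_cont_glue => //; split; apply: pw_cont_const; lra.
- move=> x; have [U0 Uev] := proj1 (generatedE _ _ _) (gU x).
  apply/generatedE; split; first by rewrite glue_le.
  have -> : Hx (glue T HD (fun=> K)) (glue T al (fun=> a)) (val x)
      = glue T (Hx HD al (val x)) (fun _ p q => Cscal c (P x p q)).
    apply: functional_extensionality => t; apply: mat_ext => p q.
    by rewrite /Hx /glue; case: Rle_dec.
  apply: evolves_glue Uev _; [lra | | exact: evolves_propagator].
  rewrite /W Rminus_diag Rmult_0_r propagator0 (proj1 (UV x)).
  by apply: mulmv_inj => v; rewrite mulmvA mulmv1.
- move=> x; split; last first.
    by move=> u v; rewrite !mulmvA propagator_isometry //; exact: (proj2 (UV x)).
  by rewrite glue_gt /W; [do 3!f_equal; ring | lra].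
Qed.

End Reachable.

(** * Reflections exchanging two families of vectors *)

Section Reflections.
Variable I : finType.

Definition madd (A B : mat I) : mat I := fun i j => (A i j + B i j)%Cx.

Lemma mulmv_madd A B v : mulmv (madd A B) v = vadd (mulmv A v) (mulmv B v).
Proof.
apply: functional_extensionality => i; rewrite /mulmv /vadd -csumD.
by apply: eq_csum => j; rewrite /madd; ring.
Qed.

(* At [e = vzero] the division by zero is harmless: the matrix vanishes. *)
Definition line_projection (e : vec I) : mat I :=
  fun i j => Cscal (/ norm2 e) (e i * (e j)^*)%Cx.

Lemma mulmv_line_projection e v :
  mulmv (line_projection e) v = vscal (Cscal (/ norm2 e) (inner e v)) e.
Proof.
apply: functional_extensionality => i; rewrite /vscal CscalE.
rewrite [RHS](_ : _ = ((/ norm2 e)%:C * e i) * inner e v)%Cx; last by ring.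
by rewrite /inner -csumZ; apply: eq_csum => j; rewrite /line_projection CscalE; ring.
Qed.

Lemma line_projection_fix e : mulmv (line_projection e) e = e.
Proof.
rewrite mulmv_line_projection inner_self.
have [e0|e_neq0] := Req_dec (norm2 e) 0; first by rewrite (norm2_eq0 e0); vec_ring.
rewrite CscalE -RtoCM Rinv_l //; exact: (vscal1 e).
Qed.

Lemma projection_line e : projection (line_projection e).
Proof.
split=> [i j|v]; first by rewrite /line_projection !CscalE !CconjE; ring.
by rewrite (mulmv_line_projection e v) mulmvZ line_projection_fix.
Qed.

Lemma projection0 : projection (fun _ _ : I => C0).
Proof. by split=> [i j|v]; [rewrite Cconj0 | rewrite !mulmv_zero_matrix]. Qed.

Lemma projectionD P Q : projection P -> projection Q ->
  (forall v, mulmv P (mulmv Q v) = vzero) -> (forall v, mulmv Q (mulmv P v) = vzero) ->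
  projection (madd P Q).
Proof.
move=> [Ph PP] [Qh QQ] PQ QP; split=> [i j|v].
  by rewrite /madd (Ph i j) (Qh i j) CconjD.
by rewrite !mulmv_madd !mulmvD PP QQ PQ QP; vec_ring.
Qed.

Lemma span_projection (Y : eqType) (F : Y -> vec I) (s : seq Y) :
  exists P, [/\ projection P, forall y, y \in s -> mulmv P (F y) = F y
    & forall w, (forall y, y \in s -> inner (F y) w = C0) -> mulmv P w = vzero].
Proof.
elim: s => [|y0 s [P [Pproj Pfix Pker]]].
  exists (fun _ _ => C0); split=> // [|w _]; first exact: projection0.
  exact: mulmv_zero_matrix.
have [Ph PP] := Pproj.
pose e := vsub (F y0) (mulmv P (F y0)); set Q := line_projection e.
have Pe : mulmv P e = vzero by rewrite mulmvB PP; vec_ring.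
have Qorth v : inner e v = C0 -> mulmv Q v = vzero.
  by rewrite mulmv_line_projection => ->; rewrite CscalE; vec_ring.
have PQ v : mulmv P (mulmv Q v) = vzero.
  by rewrite mulmv_line_projection mulmvZ Pe; vec_ring.
have QP v : mulmv Q (mulmv P v) = vzero.
  by apply: Qorth; rewrite inner_hermitian // Pe inner0l.
exists (madd P Q); split.
- by apply: projectionD => //; exact: projection_line.
- move=> y; rewrite inE mulmv_madd => /predU1P [->|ys]; last first.
    by rewrite -(Pfix y ys) QP PP; vec_ring.
  have F0E : F y0 = vadd (mulmv P (F y0)) e by rewrite /e; vec_ring.
  have -> : mulmv Q (F y0) = e.
    by rewrite {1}F0E mulmvD QP line_projection_fix; vec_ring.
  by rewrite -F0E.
- move=> w orth; have Pw : mulmv P w = vzero.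
    by apply: Pker => y ys; apply: orth; rewrite inE ys orbT.
  rewrite mulmv_madd Pw Qorth; first by vec_ring.
  by rewrite innerBl orth ?mem_head // -inner_hermitian // Pw inner0r; ring.
Qed.

(* The reflection negates the span of the differences [p x - q x]; by the two
   hypotheses the sums [p x + q x] are orthogonal to it, hence fixed. *)
Lemma reflection_exchange (Y : finType) (p q : Y -> vec I) :
  (forall x y, inner (p x) (p y) = inner (q x) (q y)) ->
  (forall x y, inner (p x) (q y) = inner (q x) (p y)) ->
  exists2 P, projection P & forall x, mulmv (propagator P PI) (p x) = q x.
Proof.
move=> gram cross.
have [P [Pproj Pfix Pker]] := span_projection (fun x => vsub (p x) (q x)) (enum Y).
exists P => // x; rewrite mulmv_propagator.
have diff := Pfix x (mem_enum Y x).
have sum : mulmv P (vadd (p x) (q x)) = vzero.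
  by apply: Pker => y _; rewrite innerBl !innerDr gram -cross; ring.
have pE : p x = vscal (1 / 2)%:C (vadd (vsub (p x) (q x)) (vadd (p x) (q x))).
  by apply: functional_extensionality => i; rewrite /vscal /vadd /vsub; by_coords.
have -> : mulmv P (p x) = vscal (1 / 2)%:C (vsub (p x) (q x)).
  by rewrite {1}pE mulmvZ mulmvD diff sum; vec_ring.
apply: functional_extensionality => i.
by rewrite /vadd /vsub /vscal /phase cos_PI sin_PI; by_coords.
Qed.

Lemma overlap_bound (V : mat I) (psi phi c0 c1 : vec I) (g : R) :
  isometry V -> mulmv V (vadd psi c0) = vadd phi c1 ->
  norm2 phi = 1 -> inner psi c0 = C0 -> inner phi c1 = C0 ->
  norm2 c0 = g -> norm2 c1 = g ->
  1 - 2 * g <= fst (inner phi (mulmv V psi)).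
Proof.
move=> Viso Vsum phi1 psi_c0 phi_c1 c0g c1g.
have Vc0 : norm2 (mulmv V c0) = g by rewrite norm2E Viso -norm2E.
have far := Re_inner_ge c1 (mulmv V c0); rewrite c1g Vc0 in far.
have catalyst := Viso (vadd psi c0) c0.
rewrite Vsum !innerDl psi_c0 inner_self c0g in catalyst.
have total : inner phi (mulmv V (vadd psi c0)) = C1.
  by rewrite Vsum innerDr phi_c1 inner_self phi1; by_coords.
rewrite mulmvD innerDr in total.
move/(f_equal fst): catalyst; move/(f_equal fst): total => /=; lra.
Qed.

End Reflections.

(** * The oracle *)

Lemma inv_sqrt2_sqr : / sqrt 2 * / sqrt 2 = 1 / 2.
Proof. by rewrite -Rinv_mult sqrt_sqrt; lra. Qed.

Lemma csum_Idx (S : finType) (n w d : nat) (F : Idx S n w d -> Cx) :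
  csum F = (csum (fun k => csum (fun j => csum (fun a => F (inl (j, a, k)))))
            + csum (fun k => F (inr k)))%Cx.
Proof.
rewrite csum_sum csum_pair csum_exchange; congr Cadd.
by apply: eq_csum => k; rewrite csum_pair.
Qed.

Section Oracle.
Variables (S : finType) (n w d : nat).
Notation I := (Idx S n w d).
Notation HQ := (@HQ S n w d).

Lemma mulmv_HQ (x : n.-tuple S) (v : vec I) j a k :
  mulmv (HQ x) v (inl (j, a, k)) = ((ycoef (tnth x j) a * / sqrt 2)%:C
    * (v (inl (j, None, k)) - v (inl (j, Some (tnth x j), k))))%Cx.
Proof.
rewrite /mulmv csum_Idx [X in (_ + X)%Cx]csum_eq0; last by move=> i /=; ring.
pose entry k' j' b := (hmat (tnth x j') a b * v (inl (j', b, k')))%Cx.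
transitivity (csum (fun b => entry k j b)).
  rewrite -(csum_delta k (fun k' => csum (entry k' j))) CaddC Cadd0; apply: eq_csum => k'.
  rewrite -csum_if.
  rewrite -(csum_delta j (fun j' => csum (fun b => if k' == k then entry k' j' b else C0))).
  apply: eq_csum => j'; rewrite -csum_if; apply: eq_csum => b.
  rewrite /entry /= (eq_sym j) (eq_sym k).
  by have [->|_] := eqVneq j' j; case: (k' == k) => //=; ring.
rewrite csum_option (_ : csum _ = csum (fun z => if z == tnth x j then
  entry k j (Some z) else C0)); first last.
  apply: eq_csum => z; rewrite /entry /=; case: ifP => // zx.
  by rewrite /hmat /= zx; by_coords.
by rewrite csum_delta /entry /hmat /= eqxx; by_coords.
Qed.

Lemma mulmv_HQ_inr (x : n.-tuple S) (v : vec I) k : mulmv (HQ x) v (inr k) = C0.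
Proof. by apply: csum_eq0 => i /=; ring. Qed.

Lemma HQ_projection (x : n.-tuple S) : projection (HQ x).
Proof.
split.
  move=> [[[j a] k]|k] [[[j' a'] k']|k'] //=; rewrite ?Cconj0 // (eq_sym j') (eq_sym k').
  by case: eqP => [->|_]; case: eqP => _ //=; rewrite /hmat; by_coords.
move=> v; apply: functional_extensionality => -[[[j a] k]|k]; last by rewrite !mulmv_HQ_inr.
rewrite !mulmv_HQ /= eqxx.
move: (v (inl (j, None, k)) - _)%Cx => z.
rewrite (_ : _ - _ = (/ sqrt 2 * / sqrt 2 + / sqrt 2 * / sqrt 2)%:C * z)%Cx; last first.
  by by_coords.
by rewrite inv_sqrt2_sqr; congr Cmul; by_coords.
Qed.

End Oracle.

Section QueryModel.
Variables (S : finType) (n : nat) (X : {set n.-tuple S}) (w d : nat).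
Notation I := (Idx S n w d).

Lemma reachable_query T (V : Xidx X -> mat I) tau : reachable T V -> 0 < tau ->
  reachable (T + tau) (fun x => mulmm (propagator (@HQ S n w d (val x)) tau) (V x)).
Proof.
move=> reachV tau0; rewrite -{2}(Rmult_1_l tau).
apply: (@reachable_step _ _ _ _ _ _ _ _ (fun _ _ => C0) 1 1) => //.
- by move=> p q; rewrite Cconj0.
- by rewrite Rabs_R1; lra.
- by move=> x; exact: HQ_projection.
- by move=> x p q; exact: Cadd0.
Qed.

(* With the oracle switched off, the driving Hamiltonian can be arbitrarily strong. *)
Lemma reachable_reflection T (V : Xidx X -> mat I) (P : mat I) e :
  reachable T V -> projection P -> 0 < e ->
  reachable (T + e) (fun x => mulmm (propagator P PI) (V x)).
Proof.
move=> reachV Pproj e0; have -> : PI = PI / e * e by field; lra.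
apply: (@reachable_step _ _ _ _ _ _ _ _
  (fun p q => Cscal (PI / e) (P p q)) 0 _ (fun=> P)) => //.
- by move=> p q; rewrite (proj1 Pproj p q) !CscalE !CconjE.
- by rewrite Rabs_R0; lra.
- by move=> x p q; rewrite !CscalE; by_coords.
Qed.

Lemma reachable_converts (rho sigma : mat (Xidx X)) eps T (V : Xidx X -> mat I)
    (psi phi : Xidx X -> vec I) :
  reachable T V -> (forall x y, inner (psi x) (psi y) = rho x y) ->
  (forall x y, inner (phi x) (phi y) = sigma x y) ->
  (forall x, sqrt (1 - eps) <= fst (inner (phi x) (mulmv (V x) (psi x)))) ->
  ct_converts rho sigma eps T.
Proof.
move=> [HD [alpha [U [[T0 HDalpha] pw gU UV]]]] psi_gram phi_gram overlap.
exists w, d, HD, alpha, U, psi, phi; split=> //.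
split; first by move=> t tT; exact: (proj1 (HDalpha t tT)).
split=> //; split; first by move=> t tT; exact: (proj2 (HDalpha t tT)).
split=> //; split=> // x; rewrite (proj1 (UV x)); exact: overlap.
Qed.

End QueryModel.

(** * The conversion algorithm *)

(* Coordinates of [cp |y^+> + cm |y^->]. *)
Definition site (S : finType) (y : S) (cp cm : Cx) (a : option S) : Cx :=
  match a with
  | None => ((/ sqrt 2)%:C * (cp + cm))%Cx
  | Some z => if z == y then ((/ sqrt 2)%:C * (cp - cm))%Cx else C0
  end.

Definition site_gram (S : finType) (y y' : S) (cp cm cp' cm' : Cx) : Cx :=
  ((1 / 2)%:C * ((cp + cm)^* * (cp' + cm')
    + (if y == y' then (cp - cm)^* * (cp' - cm') else C0)))%Cx.

Lemma inner_site (S : finType) (y y' : S) cp cm cp' cm' :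
  csum (fun a => (site y cp cm a)^* * site y' cp' cm' a)%Cx = site_gram y y' cp cm cp' cm'.
Proof.
rewrite csum_option /= (_ : csum _ = csum (fun z => if z == y then (if y == y' then
  (/ sqrt 2 * / sqrt 2)%:C * ((cp - cm)^* * (cp' - cm')) else C0) else C0))%Cx; last first.
  apply: eq_csum => z; have [->|_] := eqVneq z y; last by rewrite Cconj0; ring.
  by case: (y == y'); rewrite ?RtoCM ?CconjE; ring.
rewrite csum_delta /site_gram CconjM Cconj_real -inv_sqrt2_sqr RtoCM.
by case: (y == y'); ring.
Qed.

Lemma site_gram_self (S : finType) (y : S) cp cm :
  site_gram y y cp cm cp cm = (Cnorm2 cp + Cnorm2 cm)%:C.
Proof. by rewrite /site_gram eqxx; by_coords. Qed.

(* The phase [z] of a query is visible only between inputs that differ at the site. *)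
Lemma site_gram_phase (S : finType) (y y' : S) z cp cm cp' cm' :
  (z^* * z = C1)%Cx ->
  site_gram y y' cp (z * cm)%Cx cp' (z * cm')%Cx
  = (site_gram y y' cp cm cp' cm' + if y != y' then
      (1 / 2)%:C * (cp^* * ((z - C1) * cm') + ((z - C1) * cm)^* * cp') else C0)%Cx.
Proof.
move=> zz; rewrite /site_gram.
by case: eqP => _ /=; rewrite !CconjE; ring [zz].
Qed.

Lemma site_query (S : finType) (y : S) z cp cm a :
  (site y cp cm a + (z - C1) * ((ycoef y a * / sqrt 2)%:C
     * (site y cp cm None - site y cp cm (Some y))))%Cx = site y cp (z * cm)%Cx a.
Proof.
have half : ((/ sqrt 2)%:C * (/ sqrt 2)%:C * (C1 + C1) = C1)%Cx.
  by rewrite -RtoCM inv_sqrt2_sqr; by_coords.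
transitivity (site y cp cm a + (z - C1) * (ycoef y a)%:C
  * ((/ sqrt 2)%:C * (/ sqrt 2)%:C * (C1 + C1)) * cm)%Cx.
  by rewrite /= eqxx RtoCM; ring.
rewrite half; case: a => [y'|] /=; last by ring.
by case: (y' == y); by_coords.
Qed.

Section CatalystStates.
Variables (S : finType) (n : nat) (A B : finType) (jl : A -> 'I_n).
Notation I := (Idx S n #|{: A * bool}| #|B|).

(* The vector [f] in the summand H' plus the catalyst [sum_l |jl l> |site l> |l, b>]. *)
Definition state (x : n.-tuple S) (cp cm : A -> Cx) (b : bool) (f : vec B) : vec I :=
  fun i => match i with
  | inl (j, a, k) =>
      let: (l, b') := enum_val k in
      if (b' == b) && (j == jl l) then site (tnth x j) (cp l) (cm l) a else C0
  | inr k => f (enum_val k)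
  end.

Lemma stateD x cp cm cp' cm' b f f' :
  state x (fun l => cp l + cp' l)%Cx (fun l => cm l + cm' l)%Cx b (vadd f f')
  = vadd (state x cp cm b f) (state x cp' cm' b f').
Proof.
apply: functional_extensionality => -[[[j a] k]|k] //; rewrite /vadd /=.
case: (enum_val k) => l b'; case: ifP => _; last by ring.
by case: a => [z|] /=; [case: (z == _)|]; ring.
Qed.

Lemma query_state x cp cm b f tau :
  mulmv (propagator (@HQ S n #|{: A * bool}| #|B| x) tau) (state x cp cm b f)
  = state x cp (fun l => phase tau * cm l)%Cx b f.
Proof.
rewrite mulmv_propagator; apply: functional_extensionality => -[[[j a] k]|k];
  rewrite /vadd /vscal; last by rewrite mulmv_HQ_inr /=; ring.
rewrite mulmv_HQ /state; case: (enum_val k) => l b'; case: ifP => _; last by ring.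
exact: site_query.
Qed.

Lemma inner_state x y cp cm cp' cm' b b' f f' :
  inner (state x cp cm b f) (state y cp' cm' b' f') =
  ((if b == b' then csum (fun l => site_gram (tnth x (jl l)) (tnth y (jl l))
                             (cp l) (cm l) (cp' l) (cm' l)) else C0) + inner f f')%Cx.
Proof.
rewrite /inner csum_Idx; congr Cadd; last first.
  exact: (csum_enum_val (fun i => (f i)^* * f' i)%Cx).
pose G (lc : A * bool) : Cx := if (lc.2 == b) && (lc.2 == b') then
  site_gram (tnth x (jl lc.1)) (tnth y (jl lc.1))
    (cp lc.1) (cm lc.1) (cp' lc.1) (cm' lc.1) else C0.
transitivity (csum (fun k : 'I_#|{: A * bool}| => G (enum_val k))).
  apply: eq_csum => k; rewrite /G /=; case: (enum_val k) => l c /=.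
  rewrite -inner_site -csum_if -[RHS](csum_delta (jl l) (fun j => csum (fun a =>
    if (c == b) && (c == b') then
      (site (tnth x j) (cp l) (cm l) a)^* * site (tnth y j) (cp' l) (cm' l) a else C0)))%Cx.
  apply: eq_csum => j; rewrite -csum_if; apply: eq_csum => a.
  by case: (c == b); case: (c == b'); case: (j == jl l); rewrite /= ?Cconj0 //; ring.
rewrite csum_enum_val csum_pair -csum_if; apply: eq_csum => l.
by rewrite csum_bool {}/G; case: b; case: b' => /=; ring.
Qed.

End CatalystStates.

Definition chord (tau : R) : R := sqrt (Cnorm2 (phase tau - C1)%Cx).

(* The unit number that rotates [phase tau - 1] onto the negative real axis. *)
Definition chord_phase (tau : R) : Cx := ((- / chord tau)%:C * (phase tau - C1)^*)%Cx.

Lemma chord_sqr tau : chord tau * chord tau = Cnorm2 (phase tau - C1)%Cx.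
Proof. by rewrite sqrt_sqrt //; exact: Cnorm2_ge0. Qed.

Lemma chord_lower_bound (tau : R) : 0 < tau <= 1 -> tau / 2 <= chord tau.
Proof.
move=> [t0 t1]; have pi_gt := PI2_1.
have [||_] := cos_bound tau 0; [lra | lra |].
rewrite /cos_approx /= /cos_term /= => cos_le.
rewrite -[tau / 2]sqrt_square; last by lra.
apply: sqrt_le_1_alt; rewrite /Cnorm2 /phase /=.
have := sin2_cos2 tau; rewrite /Rsqr.
have sqr0 : 0 <= tau * tau by nra.
have : tau * tau * (tau * tau) <= tau * tau * 1 by apply: Rmult_le_compat_l; nra.
by lra.
Qed.

Lemma chord_phaseE tau : 0 < chord tau ->
  ((phase tau - C1) * chord_phase tau = (- chord tau)%:C)%Cx.
Proof.
move=> q0; rewrite /chord_phase.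
transitivity ((- / chord tau)%:C * ((phase tau - C1)^* * (phase tau - C1)))%Cx.
  by ring.
by rewrite Cconj_mul_self -chord_sqr -RtoCM; congr RtoC; field; lra.
Qed.

Lemma Cnorm2_chord_phase tau : 0 < chord tau -> Cnorm2 (chord_phase tau) = 1.
Proof.
by move=> q0; rewrite /chord_phase Cnorm2M Cnorm2_conj Cnorm2_real -chord_sqr; field; lra.
Qed.

Section Conversion.
Variables (S : finType) (n : nat) (X : {set n.-tuple S}) (A : finType).
Variables (jl : A -> 'I_n) (u v : A -> vec (Xidx X)).
Variables (rho sigma : mat (Xidx X)) (m1 m2 : nat).
Variables (r : Xidx X -> vec 'I_m1) (s : Xidx X -> vec 'I_m2).
Hypothesis rho_gram : forall x y, rho x y = inner (r x) (r y).
Hypothesis sigma_gram : forall x y, sigma x y = inner (s x) (s y).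
Hypothesis dual_family : dual_mat (@differ S n X) jl u v = msub rho sigma.

Variables (N : nat) (tau : R).
Hypothesis N_gt0 : 0 < INR N.
Hypothesis chord_gt0 : 0 < chord tau.

Notation B := ('I_m1 + 'I_m2)%type.
Notation I := (Idx S n #|{: A * bool}| #|{: B}|).

Definition mixture (a b : R) (x : Xidx X) : vec B :=
  fun i => match i with inl i => (a%:C * r x i)%Cx | inr i => (b%:C * s x i)%Cx end.

Lemma inner_mixture a b a' b' x y : inner (mixture a b x) (mixture a' b' y)
  = ((a * a')%:C * rho x y + (b * b')%:C * sigma x y)%Cx.
Proof.
rewrite rho_gram sigma_gram /inner csum_sum /= -!csumZ.
by congr Cadd; apply: eq_csum => i; rewrite RtoCM !CconjE; ring.
Qed.

Let kap := sqrt (/ (INR N * chord tau)).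

Definition cat_plus (x : Xidx X) (l : A) : Cx := (kap%:C * v l x)%Cx.
Definition cat_minus (x : Xidx X) (l : A) : Cx := (kap%:C * (chord_phase tau * u l x))%Cx.

Lemma kap_sqr : kap * kap = / (INR N * chord tau).
Proof.
have inv_gt0 := Rinv_0_lt_compat _ (Rmult_lt_0_compat _ _ N_gt0 chord_gt0).
by rewrite sqrt_sqrt //; lra.
Qed.

Definition catalyst_gram (z : Cx) (x y : Xidx X) : Cx :=
  csum (fun l => site_gram (tnth (val x) (jl l)) (tnth (val y) (jl l))
    (cat_plus x l) (z * cat_minus x l) (cat_plus y l) (z * cat_minus y l))%Cx.

Lemma catalyst_gram_query x y : catalyst_gram (phase tau) x y
  = (catalyst_gram C1 x y + (- / INR N)%:C * msub rho sigma x y)%Cx.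
Proof.
rewrite -dual_family /catalyst_gram /dual_mat -csumZ -csumD; apply: eq_csum => l.
rewrite (site_gram_phase _ _ _ _ _ _ (phase_unitary tau)).
rewrite (_ : C1 * cat_minus x l = cat_minus x l)%Cx; last by ring.
rewrite (_ : C1 * cat_minus y l = cat_minus y l)%Cx; last by ring.
congr Cadd; rewrite /mask /differ; case: ifP => _; last by ring.
have rotate w : ((phase tau - C1) * cat_minus w l = kap%:C * (- chord tau)%:C * u l w)%Cx.
  by rewrite -chord_phaseE // /cat_minus; ring.
have scale : ((- / INR N)%:C = kap%:C * (kap%:C * (- chord tau)%:C))%Cx.
  by rewrite -!RtoCM -Rmult_assoc kap_sqr; congr RtoC; field; lra.
by rewrite !rotate scale /cat_plus /symprod !CconjE; ring.
Qed.

(* The flag [odd k] makes the catalysts of consecutive stages orthogonal, so that their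
   cross Gram matrix is that of the mixtures, hence symmetric as the reflection needs. *)
Definition stage (k : nat) (z : Cx) (x : Xidx X) : vec I :=
  state jl (val x) (cat_plus x) (fun l => z * cat_minus x l)%Cx (odd k)
    (mixture (sqrt (1 - INR k / INR N)) (sqrt (INR k / INR N)) x).

Lemma INR_ratio_bounds k : (k <= N)%N -> 0 <= INR k / INR N <= 1.
Proof.
move=> kN; have kN' : INR k <= INR N by apply/le_INR/leP.
have ratioE : INR k / INR N * INR N = INR k by field; lra.
by have := pos_INR k; split; apply: (Rmult_le_reg_r (INR N)); lra.
Qed.

Lemma stage_gram k x y : (k < N)%N ->
  inner (stage k (phase tau) x) (stage k (phase tau) y)
  = inner (stage k.+1 C1 x) (stage k.+1 C1 y).
Proof.
move=> kN; have := INR_ratio_bounds (ltnW kN); have := INR_ratio_bounds kN => bound1 bound0.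
rewrite /stage !inner_state !eqxx.
rewrite -/(catalyst_gram (phase tau) x y) -/(catalyst_gram C1 x y).
rewrite catalyst_gram_query !inner_mixture !sqrt_sqrt; try lra.
by rewrite S_INR /msub; apply: Cx_eq; rewrite /=; field; lra.
Qed.

Lemma stage_cross_gram k x y :
  inner (stage k (phase tau) x) (stage k.+1 C1 y)
  = inner (stage k.+1 C1 x) (stage k (phase tau) y).
Proof.
have flags : (odd k == odd k.+1) = false by rewrite /=; case: (odd k).
by rewrite /stage !inner_state flags eq_sym flags !inner_mixture; by_coords.
Qed.

Lemma reachable_stage (e : R) (k : nat) : 0 < tau -> 0 < e -> (k <= N)%N ->
  exists2 V : Xidx X -> mat I, reachable (INR k * (tau + e)) V
    & forall x, mulmv (V x) (stage 0 C1 x) = stage k C1 x.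
Proof.
move=> tau0 e0; elim: k => [|k IH] kN.
  exists (fun=> @idmat I); last by move=> x; rewrite mulmv1.
  by rewrite Rmult_0_l; exact: reachable0.
have [V reachV Vstage] := IH (ltnW kN).
have [P Pproj Pstage] :=
  reflection_exchange (fun x y => stage_gram x y kN) (stage_cross_gram k).
have := reachable_reflection (reachable_query reachV tau0) Pproj e0.
set V' := fun x => mulmm (propagator P PI) _ => reachV'; exists V'.
  by rewrite S_INR (_ : _ * _ = INR k * (tau + e) + tau + e) //; ring.
move=> x; rewrite /V' !mulmvA Vstage -Pstage; congr mulmv.
rewrite /stage query_state; congr state.
by apply: functional_extensionality => l; ring.
Qed.

Definition catalyst (b : bool) (x : Xidx X) : vec I :=
  state jl (val x) (cat_plus x) (cat_minus x) b vzero.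

Definition uncatalyzed (b : bool) (f : vec B) (x : Xidx X) : vec I :=
  state jl (val x) (fun=> C0) (fun=> C0) b f.

Lemma stage_split k x : stage k C1 x = vadd
  (uncatalyzed (odd k) (mixture (sqrt (1 - INR k / INR N)) (sqrt (INR k / INR N)) x) x)
  (catalyst (odd k) x).
Proof.
rewrite /uncatalyzed /catalyst -stateD /stage; congr state.
- by apply: functional_extensionality => l; ring.
- by apply: functional_extensionality => l; ring.
- by vec_ring.
Qed.

Lemma inner_uncatalyzed b b' f f' (x y : Xidx X) cp cm :
  inner (uncatalyzed b f x) (state jl (val y) cp cm b' f') = inner f f'.
Proof.
rewrite inner_state (_ : csum _ = C0); first by case: ifP => _; exact: Cadd0.
by apply: csum_eq0 => l; rewrite /site_gram; case: ifP => _; rewrite !CconjE; ring.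
Qed.

Lemma norm2_catalyst b x :
  norm2 (catalyst b x) = 2 * dual_weight u v x / (INR N * chord tau).
Proof.
rewrite norm2E inner_state eqxx inner0r /= Rplus_0_r fst_csum /Rdiv -kap_sqr.
rewrite (_ : 2 * _ * _ = (2 * (kap * kap)) * dual_weight u v x); last by ring.
rewrite -rsumZ; apply: eq_rsum => l.
have plusE : Cnorm2 (cat_plus x l) = kap * kap * Cnorm2 (v l x).
  by rewrite /cat_plus Cnorm2M Cnorm2_real.
have minusE : Cnorm2 (cat_minus x l) = kap * kap * Cnorm2 (u l x).
  by rewrite /cat_minus 2!Cnorm2M Cnorm2_real Cnorm2_chord_phase // Rmult_1_l.
by rewrite site_gram_self /= plusE minusE /pair_weight; field.
Qed.

Lemma conversion (eps e : R) :
  unit_gram sigma -> 0 < tau -> 0 < e ->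
  (forall x, sqrt (1 - eps) <= 1 - 4 * dual_weight u v x / (INR N * chord tau)) ->
  ct_converts rho sigma eps (INR N * (tau + e)).
Proof.
move=> sigma1 tau0 e0 weight_le.
have [V reachV Vstage] := reachable_stage tau0 e0 (leqnn N).
have start x : stage 0 C1 x = vadd (uncatalyzed false (mixture 1 0 x) x) (catalyst false x).
  by rewrite stage_split /= Rdiv_0_l Rminus_0_r sqrt_0 sqrt_1.
have finish x :
    stage N C1 x = vadd (uncatalyzed (odd N) (mixture 0 1 x) x) (catalyst (odd N) x).
  by rewrite stage_split Rdiv_diag ?Rminus_diag ?sqrt_0 ?sqrt_1 //; lra.
apply: (reachable_converts reachV (psi := fun x => uncatalyzed false (mixture 1 0 x) x)
  (phi := fun x => uncatalyzed (odd N) (mixture 0 1 x) x)) => [x y|x y|x].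
- by rewrite inner_uncatalyzed inner_mixture; by_coords.
- by rewrite inner_uncatalyzed inner_mixture; by_coords.
apply: Rle_trans (weight_le x) _.
rewrite (_ : 4 * _ / _ = 2 * (2 * dual_weight u v x / (INR N * chord tau))); last first.
  by field; lra.
apply: (@overlap_bound _ _ _ _ (catalyst false x) (catalyst (odd N) x)).
- by have [? [? [? [_ _ _ UV]]]] := reachV; exact: (proj2 (UV x)).
- by rewrite -start Vstage finish.
- by rewrite norm2E inner_uncatalyzed inner_mixture (unit_gram_diag x sigma1) /=; ring.
- by rewrite inner_uncatalyzed inner0r.
- by rewrite inner_uncatalyzed inner0r.
- exact: norm2_catalyst.
- exact: norm2_catalyst.
Qed.

End Conversion.

Lemma sqrt_one_minus_le x : 0 <= x <= 2 -> sqrt (1 - x) <= 1 - x / 2.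
Proof.
by move=> x02; rewrite -[1 - x / 2]sqrt_square; [apply: sqrt_le_1_alt; nra | lra].
Qed.

Lemma ct_converts_of_dual_decomp (S : finType) (n : nat) (X : {set n.-tuple S})
    (rho sigma : mat (Xidx X)) (t : Xidx X -> R) (W eps e : R) :
  unit_gram rho -> unit_gram sigma -> 0 < eps <= 1 -> 0 < e -> 0 < W ->
  dual_decomp (@differ S n X) (msub rho sigma) t -> (forall x, t x <= W) ->
  ct_converts rho sigma eps (16 * W / eps + e).
Proof.
move=> [m1 [r [_ rho_gram]]] sigma1 eps01 e0 W0 [A [jl [u [v [dual_family <-]]]]] weight_le.
have [m2 [s [_ sigma_gram]]] := sigma1.
set T := 16 * W / eps; have T0 : 0 < T by apply: Rdiv_lt_0_compat; lra.
have [N TN] := INR_unbounded T; have N0 : 0 < INR N by lra.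
pose tau := T / INR N.
have NtauE : INR N * tau = T by rewrite /tau; field; lra.
have tau01 : 0 < tau <= 1.
  split; first exact: Rdiv_lt_0_compat.
  by apply: (Rmult_le_reg_l (INR N)) => //; lra.
have chord_lb := chord_lower_bound tau01.
have -> : T + e = INR N * (tau + e / INR N).
  by rewrite Rmult_plus_distr_l NtauE; field; lra.
apply: (conversion rho_gram sigma_gram dual_family) => //; try lra.
  exact: Rdiv_lt_0_compat.
move=> x; apply: Rle_trans (sqrt_one_minus_le _) _; first by lra.
have Nchord : T / 2 <= INR N * chord tau.
  by rewrite -NtauE /Rdiv Rmult_assoc; apply: Rmult_le_compat_l; lra.
suff : 4 * dual_weight u v x / (INR N * chord tau) <= eps / 2 by lra.
apply: (Rmult_le_reg_r (INR N * chord tau)); first by lra.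
rewrite /Rdiv Rmult_assoc Rinv_l ?Rmult_1_r; last by lra.
have : eps / 2 * (T / 2) <= eps / 2 * (INR N * chord tau) by apply: Rmult_le_compat_l; lra.
have -> : eps / 2 * (T / 2) = 4 * W by rewrite /T; field; lra.
by have := weight_le x; lra.
Qed.

Theorem theorem4p1 :
  exists C : R, 0 < C /\
    forall (S : finType) (n : nat) (X : {set n.-tuple S})
           (rho sigma : mat (Xidx X)) (eps adv : R),
      (1 <= n)%nat ->
      unit_gram rho -> unit_gram sigma ->
      0 < eps < 1 ->
      is_Adv rho sigma adv ->
      forall delta : R, 0 < delta ->
        exists T : R, ct_converts rho sigma eps T /\ T <= C * adv / eps + delta.
Proof.
exists 16; split; first lra.
move=> S n X rho sigma eps adv n1 rho1 sigma1 eps01 adv_lub delta delta0.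
pose slack := delta * eps / 32.
have slack0 : 0 < slack by rewrite /slack; nra.
have [t decomp weight_le] := Adv_dual adv_lub n1 rho1 sigma1 slack0.
exists (16 * (adv + slack) / eps + delta / 2); split.
  have adv0 := Adv_ge0 adv_lub.
  by apply: (ct_converts_of_dual_decomp rho1 sigma1 _ _ _ decomp weight_le); lra.
by right; rewrite /slack; field; lra.
Qed.
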